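(* Let $E$ be the fundamental group of the sapphire manifold defined by $B=\begin{pmatrix} r&s\\ t&u\end{pmatrix}\in GL_2(\mathbb{Z})$ with $\det B=1$ and $rstu\neq 0$. Then the short exact sequence $$1\to \mathrm{Aut}_0(E)\to \mathrm{Aut}(E)\to \mathbb{Z}_2\to 1$$ splits. Hence $$\mathrm{Aut}(E)\cong \mathrm{Aut}_0(E)\rtimes_\alpha \mathbb{Z}_2\cong \bigl[\bigl[(\mathbb{Z}\oplus\mathbb{Z})\rtimes_{-I_2}\mathbb{Z}_2\bigr]\rtimes_\omega \mathbb{Z}\bigr]\rtimes_\zeta \mathbb{Z}_2 .$$
   Context: $\mathbb{Z}_n=\mathbb{Z}/n\mathbb{Z}$. The group $E$ has the presentation $$E=\langle d,b,v,a \mid db=bd,\ vdv^{-1}=\theta(d),\ vbv^{-1}=\theta(b),\ a^2=d,\ ab=b^{-1}a,\ ava^{-1}=d^{\,r-ru-st}b^{\,s-2su}v^{-1}\rangle,$$ where $d^xb^y$ is identified with the column vector $\begin{pmatrix} x \\ y \end{pmatrix}$ and $\theta=\theta(1)=\begin{pmatrix} ru+st&-2rt\\ -2su&ru+st\end{pmatrix}$ (an Anosov matrix). The subgroup $\langle d,b,v\rangle\cong(\mathbb{Z}\oplus\mathbb{Z})\rtimes_\theta\mathbb{Z}$ has index $2$ and is characteristic in $E$, and $\langle d,b\rangle\cong\mathbb{Z}\oplus\mathbb{Z}$ is characteristic in it; so every automorphism of $E$ induces $\pm\mathrm{id}$ on $\langle d,b,v\rangle/\langle d,b\rangle\cong\mathbb{Z}$.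 $\mathrm{Aut}_0(E)$ is the subgroup of automorphisms inducing $+\mathrm{id}$ (type I), and $\mathrm{Aut}(E)\to\mathbb{Z}_2$ records the sign (type II automorphisms, inducing $-\mathrm{id}$, go to the generator). Every $\varphi\in \mathrm{Aut}_0(E)$ satisfies $\varphi(a)=d^mb^nv^ka$ for some integers $m,n,k$; $\mathrm{Aut}_0^k(E)$ denotes the set of those with the given $k$. The map $\varphi\mapsto k$ is a homomorphism $\mathrm{Aut}_0(E)\to\mathbb{Z}$ with kernel $\mathrm{Aut}_0^0(E)\cong(\mathbb{Z}\oplus\mathbb{Z})\rtimes_{-I_2}\mathbb{Z}_2$, where the generator of $\mathbb{Z}_2$ acts by $-I_2$. The symbol $\rtimes_\omega\mathbb{Z}$ means that the generator of $\mathbb{Z}$ acts as conjugation by an element $\omega\in \mathrm{Aut}_0(E)$ whose image generates the image of this homomorphism ($\omega\in \mathrm{Aut}_0^1(E)$ if that set is nonempty, $\omega\in \mathrm{Aut}_0^2(E)$ otherwise). The symbols $\rtimes_\alpha\mathbb{Z}_2$ and $\rtimes_\zeta\mathbb{Z}_2$ mean that the generator of $\mathbb{Z}_2$ acts as conjugation by the type II automorphism $\zeta$ of order $2$ given by $\zeta(d^xb^y)=d^xb^{-y}$, $\zeta(v)=d^{\,r-ru}b^{\,s-su}v^{-1}$, $\zeta(a)=a$. *)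

(* Defs.v *)
From HB Require Import structures.
From mathcomp Require Import all_boot all_order all_algebra.
From mathcomp Require Import generic_quotient boolp.

Set Implicit Arguments.
Unset Strict Implicit.
Unset Printing Implicit Defensive.

Import GRing.Theory.
Local Open Scope quotient_scope.
Local Open Scope group_scope.

(* Plain [_ \o _] is used for the product, so (f * g) x = f (g x). *)
Section Automorphisms.
Variable G : groupType.

Definition is_aut (f : G -> G) : bool :=
  `[< {morph f : x y / x * y} /\ bijective f >].

Record aut := Aut { aut_fun :> G -> G; autP : is_aut aut_fun }.

HB.instance Definition _ := [isSub for aut_fun].
HB.instance Definition _ := [Choice of aut by <:].

Lemma autM (f : aut) : {morph f : x y / x * y}.
Proof. by case/asboolP: (autP f). Qed.

Lemma aut_bij (f : aut) : bijective f.
Proof. by case/asboolP: (autP f). Qed.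

Lemma aut_ext (f g : aut) : f =1 g -> f = g.
Proof. by move=> fg; apply/val_inj/funext. Qed.

Fact aut1_subproof : is_aut (fun x : G => x).
Proof. by apply/asboolP; split=> //; exists id. Qed.

Fact autM_subproof (f g : aut) : is_aut (f \o g).
Proof.
apply/asboolP; split=> [x y|]; first by rewrite /= !autM.
exact: bij_comp (aut_bij f) (aut_bij g).
Qed.

Fact aut_surj (f : aut) (y : G) : exists x, f x = y.
Proof. by have [g fK gK] := aut_bij f; exists (g y). Qed.

Definition aut_inv_fun (f : aut) (y : G) : G := projT1 (cid (aut_surj f y)).

Lemma aut_invK (f : aut) : cancel (aut_inv_fun f) f.
Proof. by move=> y; rewrite /aut_inv_fun; case: cid. Qed.

Lemma autK (f : aut) : cancel f (aut_inv_fun f).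
Proof. by move=> x; apply: (bij_inj (aut_bij f)); rewrite aut_invK. Qed.

Fact autV_subproof (f : aut) : is_aut (aut_inv_fun f).
Proof.
apply/asboolP; split=> [x y|]; last by exists f; [exact: aut_invK|exact: autK].
by apply: (bij_inj (aut_bij f)); rewrite autM !aut_invK.
Qed.

Definition aut_one := Aut aut1_subproof.
Definition aut_mul (f g : aut) := Aut (autM_subproof f g).
Definition aut_inv (f : aut) := Aut (autV_subproof f).

Fact aut_mulA : associative aut_mul.
Proof. by move=> f g h; apply: aut_ext. Qed.
Fact aut_mul1 : left_id aut_one aut_mul.
Proof. by move=> f; apply: aut_ext. Qed.
Fact aut_1mul : right_id aut_one aut_mul.
Proof. by move=> f; apply: aut_ext. Qed.
Fact aut_mulV : left_inverse aut_one aut_inv aut_mul.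
Proof. by move=> f; apply: aut_ext => x /=; rewrite autK. Qed.
Fact aut_Vmul : right_inverse aut_one aut_inv aut_mul.
Proof. by move=> f; apply: aut_ext => x /=; rewrite aut_invK. Qed.

HB.instance Definition _ :=
  isGroup.Build aut aut_mulA aut_mul1 aut_1mul aut_mulV aut_Vmul.

End Automorphisms.

Section GroupNotions.
Variables N G Q : groupType.

Definition isog : Prop := exists f : {multiplicative G -> Q}, bijective f.

Definition short_exact (i : N -> G) (p : G -> Q) : Prop :=
  [/\ {morph i : x y / x * y}, {morph p : x y / x * y},
      injective i, forall q, exists g, p g = q
    & forall g, p g = 1 <-> exists n, i n = g].

Definition splits (p : G -> Q) : Prop :=
  exists s : {multiplicative Q -> G}, cancel s p.

(* [tau] is conjugation by [g], read through the embedding [f] of N in G. *)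
Definition conj_through (f : N -> G) (g : G) (tau : aut N) : Prop :=
  forall x, f (tau x) = g * f x * g^-1.

Definition zexpg (x : G) (z : int) : G :=
  match z with Posz n => x ^+ n | Negz n => x ^- n.+1 end.

Inductive generated (S : G -> Prop) : G -> Prop :=
| generated_in x : S x -> generated S x
| generated1 : generated S 1
| generatedM x y : generated S x -> generated S y -> generated S (x * y)
| generatedV x : generated S x -> generated S x^-1.

End GroupNotions.

Arguments isog : clear implicits.

(* The carrier does not mention [act]; only the group law below does. *)
Definition sdprod (N H : groupType) (act : {multiplicative H -> aut N}) : Type :=
  (N * H)%type.

HB.instance Definition _ (N H : groupType) (act : {multiplicative H -> aut N}) :=
  Choice.on (sdprod act).

Section SemidirectProduct.
Variables (N H : groupType) (act : {multiplicative H -> aut N}).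

Local Notation sdprod := (sdprod act).

Definition sdprod_one : sdprod := (1, 1).
Definition sdprod_mul (x y : sdprod) : sdprod :=
  (x.1 * act x.2 y.1, x.2 * y.2).
Definition sdprod_inv (x : sdprod) : sdprod :=
  (act x.2^-1 x.1^-1, x.2^-1).

Lemma sdprod_act1 x : act 1 x = x.
Proof.
have: act 1 * act 1 = act 1 by rewrite -gmulfM mulg1.
by move/(canRL (mulKg _)); rewrite mulVg => ->.
Qed.

Lemma sdprod_actM h k x : act (h * k) x = act h (act k x).
Proof. by rewrite gmulfM. Qed.

Lemma sdprod_act_one h : act h 1 = 1.
Proof.
have: act h 1 * act h 1 = act h 1 by rewrite -autM mulg1.
by move/(canRL (mulKg _)); rewrite mulVg.
Qed.

Fact sdprod_mulA : associative sdprod_mul.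
Proof.
move=> x y z; rewrite /sdprod_mul /=; congr pair; last exact: mulgA.
by rewrite sdprod_actM autM mulgA.
Qed.
Fact sdprod_mul1 : left_id sdprod_one sdprod_mul.
Proof. by case=> n h; rewrite /sdprod_mul /= sdprod_act1 !mul1g. Qed.
Fact sdprod_1mul : right_id sdprod_one sdprod_mul.
Proof. by case=> n h; rewrite /sdprod_mul /= sdprod_act_one !mulg1. Qed.
Fact sdprod_mulV : left_inverse sdprod_one sdprod_inv sdprod_mul.
Proof.
case=> n h; rewrite /sdprod_mul /= -autM !mulVg sdprod_act_one //.
Qed.
Fact sdprod_Vmul : right_inverse sdprod_one sdprod_inv sdprod_mul.
Proof.
by case=> n h; rewrite /sdprod_mul /= -sdprod_actM !mulgV sdprod_act1 mulgV.
Qed.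

HB.instance Definition _ :=
  isGroup.Build sdprod sdprod_mulA sdprod_mul1 sdprod_1mul
    sdprod_mulV sdprod_Vmul.

End SemidirectProduct.

(* The group < X | rels >.  A word is a sequence of letters, (x, true) standing
   for the generator x and (x, false) for its inverse; a pair (u, w) in [rels]
   is the relation u = w. *)
Section Presentation.
Variable X : choiceType.

Definition word := seq (X * bool).

Definition winv (w : word) : word := rev [seq (l.1, ~~ l.2) | l <- w].

Definition wexp (x : X) (z : int) : word :=
  match z with
  | Posz n => nseq n (x, true)
  | Negz n => nseq n.+1 (x, false)
  end.

Variable rels : seq (word * word).

Inductive word_eqv : word -> word -> Prop :=
| word_eqv_refl u : word_eqv u u
| word_eqv_sym u w : word_eqv u w -> word_eqv w u
| word_eqv_trans u w z : word_eqv u w -> word_eqv w z -> word_eqv u z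
| word_eqv_cat u u' w w' :
    word_eqv u u' -> word_eqv w w' -> word_eqv (u ++ w) (u' ++ w')
| word_eqv_cancel x e : word_eqv [:: (x, e); (x, ~~ e)] [::]
| word_eqv_rel u w : (u, w) \in rels -> word_eqv u w.

Definition word_eqvb (u w : word) : bool := `[< word_eqv u w >].

Fact word_eqvb_refl : reflexive word_eqvb.
Proof. by move=> u; apply/asboolP/word_eqv_refl. Qed.
Fact word_eqvb_sym : symmetric word_eqvb.
Proof. by move=> u w; apply/asboolP/asboolP; apply: word_eqv_sym. Qed.
Fact word_eqvb_trans : transitive word_eqvb.
Proof.
by move=> w u z /asboolP uw /asboolP wz; apply/asboolP/(word_eqv_trans uw wz).
Qed.

Canonical word_equiv :=
  EquivRel word_eqvb word_eqvb_refl word_eqvb_sym word_eqvb_trans.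

Definition presented : Type := {eq_quot word_equiv}.

HB.instance Definition _ := Choice.on presented.

Definition class_of_word (w : word) : presented :=
  (\pi_({eq_quot word_equiv}) w)%qT.

Lemma class_of_wordP u w :
  class_of_word u = class_of_word w <-> word_eqv u w.
Proof.
split=> [/eqP|uw]; first by rewrite /class_of_word eqmodE => /asboolP.
by apply/eqP; rewrite /class_of_word eqmodE; apply/asboolP.
Qed.

Lemma class_of_wordK (x : presented) :
  class_of_word (repr (x : {eq_quot word_equiv})) = x.
Proof. by rewrite /class_of_word reprK. Qed.

Lemma winv_cat u w : winv (u ++ w) = winv w ++ winv u.
Proof. by rewrite /winv map_cat rev_cat. Qed.

Lemma winvK : involutive winv.
Proof.
by move=> w; rewrite /winv map_rev revK -map_comp map_id_in // => -[x e] _ /=;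
  rewrite negbK.
Qed.

Lemma word_eqv_mulV w : word_eqv (w ++ winv w) [::].
Proof.
elim: w => [|[x e] w IHw]; first exact: word_eqv_refl.
rewrite -cat1s winv_cat -!catA.
apply: (@word_eqv_trans _ ([:: (x, e)] ++ [::] ++ winv [:: (x, e)])).
  apply: word_eqv_cat; first exact: word_eqv_refl.
  rewrite [w ++ _]catA.
  by apply: word_eqv_cat => //; exact: word_eqv_refl.
exact: word_eqv_cancel.
Qed.

Lemma word_eqv_Vmul w : word_eqv (winv w ++ w) [::].
Proof. by have := word_eqv_mulV (winv w); rewrite winvK. Qed.

Lemma word_eqv_inv u w : word_eqv u w -> word_eqv (winv u) (winv w).
Proof.
move=> uw; have r := word_eqv_refl.
apply: (@word_eqv_trans _ (winv u ++ (w ++ winv w))).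
  rewrite -[X in word_eqv X _]cats0.
  by apply: word_eqv_cat => //; apply/word_eqv_sym/word_eqv_mulV.
rewrite catA -[X in word_eqv _ X]cat0s; apply: word_eqv_cat => //.
apply: word_eqv_trans (word_eqv_Vmul u).
by apply: word_eqv_cat => //; apply: word_eqv_sym.
Qed.

Definition presented_one : presented := class_of_word [::].
Definition presented_mul (x y : presented) : presented :=
  class_of_word (repr (x : {eq_quot word_equiv}) ++
                 repr (y : {eq_quot word_equiv})).
Definition presented_inv (x : presented) : presented :=
  class_of_word (winv (repr (x : {eq_quot word_equiv}))).

Lemma presented_mulE u w :
  presented_mul (class_of_word u) (class_of_word w) = class_of_word (u ++ w).
Proof.
by apply/class_of_wordP/word_eqv_cat; apply/class_of_wordP;
  rewrite class_of_wordK.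
Qed.

Lemma presented_invE u :
  presented_inv (class_of_word u) = class_of_word (winv u).
Proof.
by apply/class_of_wordP/word_eqv_inv/class_of_wordP; rewrite class_of_wordK.
Qed.

Fact presented_mulA : associative presented_mul.
Proof.
move=> x y z.
by rewrite -[x]class_of_wordK -[y]class_of_wordK -[z]class_of_wordK
  !presented_mulE catA.
Qed.
Fact presented_mul1 : left_id presented_one presented_mul.
Proof. by move=> x; rewrite -[x]class_of_wordK presented_mulE. Qed.
Fact presented_1mul : right_id presented_one presented_mul.
Proof. by move=> x; rewrite -[x]class_of_wordK presented_mulE cats0. Qed.
Fact presented_mulV : left_inverse presented_one presented_inv presented_mul.
Proof.
move=> x; rewrite -[x]class_of_wordK presented_invE presented_mulE.
exact/class_of_wordP/word_eqv_Vmul.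
Qed.
Fact presented_Vmul : right_inverse presented_one presented_inv presented_mul.
Proof.
move=> x; rewrite -[x]class_of_wordK presented_invE presented_mulE.
exact/class_of_wordP/word_eqv_mulV.
Qed.

HB.instance Definition _ :=
  isGroup.Build presented presented_mulA presented_mul1 presented_1mul
    presented_mulV presented_Vmul.

Definition pgen (x : X) : presented := class_of_word [:: (x, true)].

End Presentation.

Variant sapphire_gen := Gd | Gb | Gv | Ga.

HB.instance Definition _ := gen_eqMixin sapphire_gen.
HB.instance Definition _ := gen_choiceMixin sapphire_gen.

Section Sapphire.
Variable B : 'M[int]_2.

Let r : int := B 0%R 0%R.
Let s : int := B 0%R 1%R.
Let t : int := B 1%R 0%R.
Let u : int := B 1%R 1%R.

Definition theta : 'M[int]_2 :=
  (\matrix_(i, j)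
    if i == 0 then (if j == 0 then r * u + s * t else - 2 * (r * t))
    else (if j == 0 then - 2 * (s * u) else r * u + s * t))%R.

Let w1 (x : sapphire_gen) : word sapphire_gen := [:: (x, true)].
Let wdb (x y : int) : word sapphire_gen := wexp Gd x ++ wexp Gb y.

Definition sapphire_rels : seq (word sapphire_gen * word sapphire_gen) :=
  [:: (w1 Gd ++ w1 Gb, w1 Gb ++ w1 Gd);
      (w1 Gv ++ w1 Gd ++ winv (w1 Gv),
       wdb (theta 0%R 0%R) (theta 1%R 0%R));
      (w1 Gv ++ w1 Gb ++ winv (w1 Gv),
       wdb (theta 0%R 1%R) (theta 1%R 1%R));
      (w1 Ga ++ w1 Ga, w1 Gd);
      (w1 Ga ++ w1 Gb, winv (w1 Gb) ++ w1 Ga);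
      (w1 Ga ++ w1 Gv ++ winv (w1 Ga),
       wdb (r - r * u - s * t)%R (s - 2 * (s * u))%R ++ winv (w1 Gv))].

Definition sapphire : groupType := presented sapphire_rels.

Definition sd : sapphire := pgen sapphire_rels Gd.
Definition sb : sapphire := pgen sapphire_rels Gb.
Definition sv : sapphire := pgen sapphire_rels Gv.
Definition sa : sapphire := pgen sapphire_rels Ga.

Definition db (x y : int) : sapphire := zexpg sd x * zexpg sb y.

Definition subDB : sapphire -> Prop :=
  generated (fun x => x = sd \/ x = sb).
Definition subDBV : sapphire -> Prop :=
  generated (fun x => [\/ x = sd, x = sb | x = sv]).

Definition AutE : groupType := aut sapphire.

(* phi restricts to <d,b> and <d,b,v>, hence acts on the quotient
   <d,b,v>/<d,b>. *)
Definition acts_on_quotient (phi : AutE) : Prop :=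
  (forall x, subDB (phi x) <-> subDB x) /\
  (forall x, subDBV (phi x) <-> subDBV x).

(* The induced automorphism of <d,b,v>/<d,b> is x |-> x, resp. x |-> x^-1. *)
Definition typeI (phi : AutE) : Prop :=
  acts_on_quotient phi /\ forall x, subDBV x -> subDB (phi x * x^-1).
Definition typeII (phi : AutE) : Prop :=
  acts_on_quotient phi /\ forall x, subDBV x -> subDB (phi x * x).

Definition Aut0_pred : {pred AutE} := [pred phi | `[< typeI phi >]].

Definition Aut0_sub : Type := {phi : AutE | phi \in Aut0_pred}.

HB.instance Definition _ := SubChoice.on Aut0_sub.

Fact Aut0_closed : group_closed Aut0_pred.
Proof.
split=> [|phi psi].
  rewrite !inE; apply/asboolP; split=> [|x _]; first by split.
  by rewrite mulgV; exact: generated1.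
rewrite !inE => /asboolP[[p1 p2] p3] /asboolP[[q1 q2] q3].
have qK x : psi (psi^-1 x) = x by exact: aut_invK.
apply/asboolP; split=> [|x xV].
  split=> x /=.
    by rewrite p1 -(q1 (aut_inv_fun psi x)) aut_invK.
  by rewrite p2 -(q2 (aut_inv_fun psi x)) aut_invK.
change (subDB (phi (psi^-1 x) * x^-1)).
have yV : subDBV (psi^-1 x) by apply/q2; rewrite qK.
set y := psi^-1 x in yV *.
have -> : phi y * x^-1 = (phi y * y^-1) * (psi y * y^-1)^-1.
  by rewrite qK invgM invgK mulgA mulgVK.
by apply: generatedM; [exact: p3 | apply/generatedV/q3].
Qed.

HB.instance Definition _ :=
  SubChoice_isSubGroup.Build AutE Aut0_pred Aut0_sub Aut0_closed.

Definition Aut0 : groupType := Aut0_sub.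

Definition Aut0_incl (phi : Aut0) : AutE := \val (phi : Aut0_sub).

Definition Aut0k (k : int) (phi : Aut0) : Prop :=
  exists m n : int, Aut0_incl phi sa = db m n * zexpg sv k * sa.

End Sapphire.

Definition grpZ : groupType := Algebra.to_multiplicative int.
Definition grpZ2 : groupType := Algebra.to_multiplicative 'Z_2.
Definition grpZZ : groupType := Algebra.to_multiplicative 'cV[int]_2.

(* The generators; note that 1%g in these groups is the zero of the ring. *)
Definition genZ : grpZ := (1%R : int).
Definition genZ2 : grpZ2 := (1%R : 'Z_2).

Definition neg_act_fun (i : grpZ2) (x : grpZZ) : grpZZ :=
  if i == 1 then x else (- 1%:M *m (x : 'cV[int]_2))%R.

Fact neg_act_subproof i : is_aut (neg_act_fun i).
Proof.
apply/asboolP; rewrite /neg_act_fun; case: (i == 1).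
  by split=> //; exists id.
split=> [x y|]; first exact: (mulmxDr (- 1%:M)%R (x : 'cV[int]_2) y).
by exists (fun x : 'cV[int]_2 => - 1%:M *m x)%R => x;
  rewrite mulmxA mulmxN mulmx1 opprK mul1mx.
Qed.

Definition neg_act (i : grpZ2) : aut grpZZ := Aut (neg_act_subproof i).

Fact neg_act_morph : {morph neg_act : i j / i * j}.
Proof.
have E (i : grpZ2) : i = 1 \/ i = genZ2.
  by case: i => -[|[|m]] // im; [left|right]; apply/val_inj.
have M x : neg_act_fun genZ2 (neg_act_fun genZ2 x) = x.
  by rewrite /neg_act_fun /= mulmxA mulmxN mulmx1 opprK mul1mx.
move=> i j; apply: aut_ext => x.
change (neg_act_fun (i * j) x = neg_act_fun i (neg_act_fun j x)).
by case: (E i) => ->; case: (E j) => ->; rewrite ?mul1g ?mulg1 ?M //.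
Qed.

HB.instance Definition _ := isMultiplicative.Build grpZ2 (aut grpZZ) neg_act
  neg_act_morph.

(* (Z (+) Z) x|_{-I_2} Z_2 *)
Definition grpK : groupType := sdprod neg_act.

Section SapphireAut.
Variable B : 'M[int]_2.

Definition Aut_sign (phi : AutE B) : grpZ2 :=
  if `[< typeII phi >] then genZ2 else 1.

Definition is_zeta (zeta : AutE B) : Prop :=
  [/\ forall x y : int, zeta (db B x y) = db B x (- y)%R,
      zeta (sv B) =
        db B (B 0 0 - B 0 0 * B 1 1)%R (B 0 1 - B 0 1 * B 1 1)%R * (sv B)^-1
    & zeta (sa B) = sa B].

Definition is_omega (omega : Aut0 B) : Prop :=
  Aut0k 1%R omega \/ (~ exists psi : Aut0 B, Aut0k 1%R psi) /\ Aut0k 2%R omega.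

End SapphireAut.

(* Main.v *)
Require Import Defs.
From HB Require Import structures.
From mathcomp Require Import all_boot all_order all_algebra.
From mathcomp Require Import generic_quotient boolp.
From mathcomp Require Import zify ring.

Set Implicit Arguments.
Unset Strict Implicit.
Unset Printing Implicit Defensive.

Import Order.TTheory GRing.Theory Num.Theory.
Local Open Scope quotient_scope.
Local Open Scope group_scope.

(** In E the lattice of translations d^x b^y is normal; v acts on it by theta
and a by the reflection J = diag(1, -1), with a v a^-1 = c v^-1.  Hence every
element is d^x b^y v^k a^e with e in {0, 1} (normal_form).  That these
coordinates are well defined is seen on an explicit action of E on triples of
integers (sol): its third coordinate yields the homomorphism from E onto the
infinite dihedral group, recorded by an integer height (the exponent k) and a
sign flip (negative when e = 1), and its first two coordinates separate the
translations.

The lattice is characteristic because it consists of the elements that commute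
with all their conjugates (subDB_self_commuting): for an element acting on the
lattice by a matrix R, commuting with its conjugates by translations forces
(1 - R)^2 = 0, which fails for theta^k with k <> 0, theta being hyperbolic, and
for the reflections theta^k J.  Then <d,b,v> is characteristic as well, being
the union of the lattice with the elements whose square is outside it.  So an
automorphism phi sends v to a translation times v^(+-1); this exponent, the
slope of phi, is the sign of phi, and type I means slope 1.

The explicit involution zeta has slope -1, so it splits the sign.  On type I
automorphisms phi, the height of phi(a), called rise here, is additive.  Its
kernel is computed from the relations: phi acts on the lattice by a matrix
commuting with theta and J, hence by a sign, and the translation parts of
phi(a) and phi(v) are solutions of one linear Diophantine equation,
u X = t Y with u and t coprime; they form a copy of Z (+) Z on which the sign
acts by inversion (kernel_classification, kernel_iso).  Conjugation by v has
rise 2, so omega, of rise 1 if possible and of rise 2 otherwise, generates the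
image of the rise, and its powers form a complement of the kernel.  Both
semidirect decompositions are instances of split_extension: a normal subgroup
with a complement makes its ambient group a semidirect product. *)

(** * Integer powers and homomorphisms *)

Section IntegerPowers.
Variable G : groupType.
Implicit Types (x y : G) (m n : int).

Lemma zexpg1 x : zexpg x 1 = x.
Proof. by []. Qed.

Lemma zexpgS x n : zexpg x (1 + n)%R = x * zexpg x n.
Proof.
case: n => [n | [|n]]; first by rewrite -PoszD -expgS.
  by rewrite /= mulgV.
have -> : (1 + Negz n.+1)%R = Negz n by lia.
by rewrite /= (expgSr _ n.+1) invgM mulVKg.
Qed.

(** Homomorphisms from Z are determined by the image of 1; this replaces
inductions on the sign of the exponent in most identities about powers. *)
Lemma zexpg_unique (f : int -> G) x :
  f 1%R = x -> (forall m n, f (m + n)%R = f m * f n) ->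
  forall n, f n = zexpg x n.
Proof.
move=> f1 fD; have f0 : f 0%R = 1.
  by apply: (mulgI (f 0%R)); rewrite -fD addr0 mulg1.
elim/int_rec => [|n IH|n IH] //.
  by rewrite -add1n PoszD fD f1 IH zexpgS.
apply: (mulgI x); rewrite -zexpgS -{1}f1 -fD.
by have -> : (1 + - n.+1%:Z = - n%:Z)%R by lia.
Qed.

Lemma zexpgD x m n : zexpg x (m + n)%R = zexpg x m * zexpg x n.
Proof.
elim/int_rec: m => [|m IH|m IH]; first by rewrite add0r mul1g.
  by rewrite -add1n PoszD -addrA !zexpgS IH mulgA.
apply: (mulgI x); rewrite mulgA -!zexpgS.
have -> : (1 + (- m.+1%:Z + n) = - m%:Z + n)%R by lia.
by have -> : (1 + - m.+1%:Z = - m%:Z)%R by lia.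
Qed.

Lemma zexpgN x n : zexpg x (- n)%R = (zexpg x n)^-1.
Proof. by apply: (mulgI (zexpg x n)); rewrite -zexpgD subrr mulgV. Qed.

Lemma zexpgVl x n : zexpg x^-1 n = zexpg x (- n)%R.
Proof.
by symmetry; apply: (@zexpg_unique (fun n => zexpg x (- n)%R)) => // a b;
  rewrite opprD zexpgD.
Qed.

(** The relations of E have the form g x = y g; in that form they pass to
powers and to products of commuting powers. *)
Lemma zexpg_intertwine g x y n :
  g * x = y * g -> g * zexpg x n = zexpg y n * g.
Proof.
move=> gx; rewrite -(@zexpg_unique (fun n => g * zexpg x n * g^-1) y).
- by rewrite mulgVK.
- by rewrite zexpg1 gx mulgK.
- by move=> a b; rewrite zexpgD !mulgA mulgVK.
Qed.

End IntegerPowers.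

Section Homomorphisms.
Variables (G H : groupType) (f : {multiplicative G -> H}).

Lemma hom1 : f 1 = 1.
Proof. by apply: (mulgI (f 1)); rewrite -gmulfM !mulg1. Qed.

Lemma homV x : f x^-1 = (f x)^-1.
Proof. by apply: (mulgI (f x)); rewrite -gmulfM !mulgV hom1. Qed.

Lemma hom_zexpg x n : f (zexpg x n) = zexpg (f x) n.
Proof.
by apply: (@zexpg_unique _ (fun n => f (zexpg x n))) => // a b;
  rewrite zexpgD gmulfM.
Qed.

End Homomorphisms.

(** * Split extensions *)

HB.instance Definition _ (G : groupType) (phi : aut G) :=
  isMultiplicative.Build G G (aut_fun phi) (autM phi).

Lemma autV (G : groupType) (phi : aut G) x : phi x^-1 = (phi x)^-1.
Proof. exact: homV. Qed.

Lemma aut_zexpg (G : groupType) (phi : aut G) x n :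
  phi (zexpg x n) = zexpg (phi x) n.
Proof. exact: hom_zexpg. Qed.

Section SplitExtensions.

Lemma isog_sym (G Q : groupType) (f : {multiplicative G -> Q}) :
  bijective f -> isog Q G.
Proof.
move=> [g fK gK].
pose g' : {multiplicative Q -> G} :=
  HB.pack g (isMultiplicative.Build Q G g (can2_gmulfM fK gK)).
by exists g'; exists f.
Qed.

Lemma grpZ_hom (G : groupType) (g : G) :
  exists s : {multiplicative grpZ -> G}, forall n, s n = zexpg g n.
Proof.
pose s : {multiplicative grpZ -> G} :=
  HB.pack (zexpg g : grpZ -> G) (isMultiplicative.Build grpZ G _ (zexpgD g)).
by exists s.
Qed.

Lemma grpZ2P (i : grpZ2) : i = 1 \/ i = genZ2.
Proof. by case: i => -[|[|m]] // im; [left|right]; apply/val_inj. Qed.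

Lemma genZ2_sqr : genZ2 * genZ2 = 1.
Proof. by apply/val_inj. Qed.

Lemma grpZ2_hom (G : groupType) (g : G) : g * g = 1 ->
  exists s : {multiplicative grpZ2 -> G}, s genZ2 = g.
Proof.
move=> gg; pose h (i : grpZ2) : G := if i == 1 then 1 else g.
have hM : {morph h : i j / i * j}.
  move=> i j; rewrite /h; case: (grpZ2P i) => ->; case: (grpZ2P j) => ->;
    by rewrite ?genZ2_sqr ?mul1g ?mulg1 ?eqxx ?mul1g ?mulg1 //= gg.
pose s : {multiplicative grpZ2 -> G} :=
  HB.pack h (isMultiplicative.Build grpZ2 G h hM).
by exists s.
Qed.

(** The splitting criterion in internal form.  N is embedded by f as a normal
subgroup, so conjugation in G restricts to N; through the complement s this
becomes the action, and multiplication in G is then the isomorphism. *)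
Lemma split_extension (N G H : groupType)
    (f : {multiplicative N -> G}) (s : {multiplicative H -> G}) :
  injective f -> (forall g x, exists y, f y = g * f x * g^-1) ->
  (forall g, exists x h, g = f x * s h) ->
  (forall x h, f x = s h -> h = 1) ->
  exists act : {multiplicative H -> aut N},
    (forall h, conj_through f (s h) (act h)) /\
  exists lambda : {multiplicative sdprod act -> G},
    bijective lambda /\ forall x h, lambda (x, h) = f x * s h.
Proof.
move=> injf nf cover disj.
pose c g x := projT1 (cid (nf g x)).
have cE g x : f (c g x) = g * f x * g^-1 by rewrite /c; case: cid.
have c_aut g : is_aut (c g).
  apply/asboolP; split=> [x y|].
    by apply: injf; rewrite gmulfM !cE gmulfM !mulgA mulgVK.
  by exists (c g^-1) => x; apply: injf; rewrite !cE invgK !mulgA;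
    rewrite ?mulVg ?mulgV mul1g ?mulgK ?mulgVK.
pose a h := Aut (c_aut (s h)).
have aM : {morph a : h k / h * k}.
  move=> h k; apply: aut_ext => x; apply: injf.
  by rewrite /= !cE gmulfM invgM !mulgA.
pose act : {multiplicative H -> aut N} :=
  HB.pack a (isMultiplicative.Build H (aut N) a aM).
exists act; split=> [h x|]; first exact: cE.
pose l (x : sdprod act) := f x.1 * s x.2.
have lM : {morph l : x y / x * y}.
  case=> [x h] [y k].
  rewrite /l [LHS]/= !gmulfM cE !mulgA mulgVK //.
pose lambda : {multiplicative sdprod act -> G} :=
  HB.pack l (isMultiplicative.Build _ G l lM).
exists lambda; split=> //.
have cov g : exists z : sdprod act, lambda z = g.
  by have [x [h ->]] := cover g; exists (x, h).
have inj : injective lambda.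
  case=> [x h] [y k]; rewrite /lambda /= /l /= => e.
  have e1 : f (y^-1 * x) = s (k * h^-1).
    by rewrite !gmulfM !homV; apply: (canRL (mulgK _)); rewrite -mulgA e mulKg.
  have kh : k = h by rewrite -[k](mulgVK h) (disj _ _ e1) mul1g.
  by move: e; rewrite kh => /mulIg/injf ->.
exists (fun g => projT1 (cid (cov g))) => [z|g]; last by case: cid.
by apply: inj; case: cid.
Qed.

End SplitExtensions.

(** * Groups given by generators and relations *)

Section Presentations.
Variable X : choiceType.

(** The evaluation takes values in an arbitrary monoid: it serves both for
homomorphisms to a group and for the action of a group on a set. *)
Lemma word_eqv_fold (rels : seq (word X * word X)) (T : Type) (idx : T)
    (op : Monoid.law idx) (ev : X * bool -> T) :
  (forall x e, op (ev (x, e)) (ev (x, ~~ e)) = idx) ->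
  (forall p, p \in rels ->
     \big[op/idx]_(l <- p.1) ev l = \big[op/idx]_(l <- p.2) ev l) ->
  forall u w, word_eqv rels u w ->
    \big[op/idx]_(l <- u) ev l = \big[op/idx]_(l <- w) ev l.
Proof.
move=> evV evR u w; elim=> {u w}.
- by [].
- by move=> u w _ ->.
- by move=> u w z _ -> _ ->.
- by move=> u u' w w' _ IHu _ IHw; rewrite !big_cat IHu IHw.
- by move=> x e; rewrite !big_cons !big_nil Monoid.mulm1 evV.
- by move=> u w uw; apply: (evR (u, w)).
Qed.

Variable rels : seq (word X * word X).

Lemma class_of_wordM u w :
  class_of_word rels (u ++ w) = class_of_word rels u * class_of_word rels w.
Proof. by rewrite -presented_mulE. Qed.

Lemma class_of_wordV u : class_of_word rels (winv u) = (class_of_word rels u)^-1.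
Proof. by rewrite -presented_invE. Qed.

(** Induction on a word that represents the element. *)
Lemma presented_ind (P : presented rels -> Prop) :
  P 1 -> (forall x g, P g -> P (pgen rels x * g)) ->
  (forall x g, P g -> P ((pgen rels x)^-1 * g)) -> forall g, P g.
Proof.
move=> P1 PM PV g; rewrite -[g]class_of_wordK.
elim: (repr _) => [|[x []] w IH] //; rewrite -cat1s class_of_wordM.
  exact: PM.
by rewrite -[[:: (x, false)]]/(winv [:: (x, true)]) class_of_wordV; exact: PV.
Qed.

Lemma presented_morph_eq (G : groupType)
    (f g : {multiplicative presented rels -> G}) :
  (forall x, f (pgen rels x) = g (pgen rels x)) -> f =1 g.
Proof.
move=> fg; elim/presented_ind => [|x h IH|x h IH]; first by rewrite !hom1.
  by rewrite !gmulfM fg IH.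
by rewrite !gmulfM !homV fg IH.
Qed.

Section Evaluation.
Variables (G : groupType) (h : X -> G).

Definition weval (w : word X) : G :=
  \prod_(l <- w) if l.2 then h l.1 else (h l.1)^-1.

Lemma weval_cat u w : weval (u ++ w) = weval u * weval w.
Proof. exact: big_cat. Qed.

Lemma weval1 x : weval [:: (x, true)] = h x.
Proof. by rewrite /weval big_cons big_nil mulg1. Qed.

Lemma weval_winv w : weval (winv w) = (weval w)^-1.
Proof.
elim: w => [|[x e] w IH]; first by rewrite /weval big_nil invg1.
rewrite -cat1s winv_cat !weval_cat IH invgM; congr (_ * _).
by rewrite /weval !big_cons !big_nil !mulg1; case: e; rewrite //= invgK.
Qed.

Lemma weval_wexp x n : weval (wexp x n) = zexpg (h x) n.
Proof.
have E b m : weval (nseq m (x, b)) = (if b then h x else (h x)^-1) ^+ m.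
  elim: m => [|m IH]; first by rewrite /weval big_nil.
  by rewrite [nseq _ _]/= -cat1s weval_cat IH expgS /weval big_cons big_nil mulg1.
by case: n => n /=; rewrite -?[_ :: _]/(nseq n.+1 _) E // expVgn.
Qed.

(** The universal property of the presentation. *)
Lemma presented_hom :
  (forall p, p \in rels -> weval p.1 = weval p.2) ->
  exists f : {multiplicative presented rels -> G},
    forall x, f (pgen rels x) = h x.
Proof.
move=> hR; pose f (g : presented rels) := weval (repr (g : {eq_quot _})).
have fE w : f (class_of_word rels w) = weval w.
  apply: (@word_eqv_fold rels) => //; first by move=> x [] /=; rewrite ?mulgV ?mulVg.
  by apply/class_of_wordP; rewrite class_of_wordK.
have fM : {morph f : a b / a * b}.
  move=> a b; rewrite -[a]class_of_wordK -[b]class_of_wordK -class_of_wordM.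
  by rewrite !fE weval_cat.
pose f' : {multiplicative presented rels -> G} :=
  HB.pack f (isMultiplicative.Build _ G f fM).
by exists f' => x; rewrite [LHS]fE weval1.
Qed.

End Evaluation.

Lemma class_of_word_weval w : class_of_word rels w = weval (pgen rels) w.
Proof.
elim: w => [|[x e] w IH]; first by rewrite /weval big_nil.
rewrite -cat1s class_of_wordM weval_cat IH; congr (_ * _).
case: e; first by rewrite weval1.
by rewrite -[[:: (x, false)]]/(winv [:: (x, true)]) class_of_wordV weval_winv weval1.
Qed.

Lemma presented_rel p : p \in rels ->
  weval (pgen rels) p.1 = weval (pgen rels) p.2.
Proof.
case: p => u w uw; rewrite -!class_of_word_weval.
by apply/class_of_wordP; apply: word_eqv_rel.
Qed.

End Presentations.

(** * Arithmetic preliminaries *)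

Lemma generated_zexpg (G : groupType) (S : G -> Prop) x n :
  generated S x -> generated S (zexpg x n).
Proof.
move=> Sx; have Sn m : generated S (zexpg x (Posz m)).
  by elim: m => [|m IH]; [exact: generated1|];
    rewrite -add1n PoszD zexpgS; exact: generatedM.
by case: n => [m|m] //; rewrite NegzE zexpgN; apply/generatedV/Sn.
Qed.

Lemma det_mx2 (R : comNzRingType) (A : 'M[R]_2) :
  (\det A = A 0 0 * A 1 1 - A 0 1 * A 1 0)%R.
Proof.
rewrite (expand_det_row _ 0%R) !big_ord_recl big_ord0 /cofactor !det_mx11 !mxE /=.
rewrite expr0 expr1 mul1r mulN1r mulrN addr0; congr (_ * _ - _ * _)%R;
  by congr (A _ _); apply/val_inj.
Qed.

(** Used with ring for polynomial identities that hold only modulo an equation,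
chiefly det B = 1; c is the cofactor of that equation. *)
Lemma eq_comb (R : pzRingType) (c l l' x y : R) :
  l = l' -> (x - y = c * (l - l'))%R -> x = y.
Proof. by move=> ->; rewrite subrr mulr0 => /eqP; rewrite subr_eq0 => /eqP. Qed.

Lemma int_unit (x y : int) : (x * y = 1 -> x = 1 \/ x = - 1)%R.
Proof.
move=> xy; have : x \is a GRing.unit by apply/unitrPr; exists y.
by case/orP=> /eqP; [left|right].
Qed.

Lemma eq_comb2 (R : pzRingType) (c c' l l' m m' x y : R) :
  l = l' -> m = m' -> (x - y = c * (l - l') + c' * (m - m'))%R -> x = y.
Proof.
by move=> -> ->; rewrite !subrr !mulr0 addr0 => /eqP; rewrite subr_eq0 => /eqP.
Qed.

(** A name for composition that can carry the structure of a monoid law. *)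
Definition fcomp (T : Type) (f g : T -> T) : T -> T := f \o g.
HB.instance Definition _ (T : Type) :=
  Monoid.isLaw.Build (T -> T) id (@fcomp T) (fun _ _ _ => erefl)
    (fun _ => erefl) (fun _ => erefl).

(** * Calculus in the sapphire group *)

Section SapphireGroup.
Variable B : 'M[int]_2.

Local Notation r := (B 0%R 0%R).
Local Notation s := (B 0%R 1%R).
Local Notation t := (B 1%R 0%R).
Local Notation u := (B 1%R 1%R).
Local Notation p := (r * u + s * t)%R.
Local Notation E := (sapphire B).
Local Notation d := (sd B).
Local Notation b := (sb B).
Local Notation v := (sv B).
Local Notation a := (sa B).
Local Notation db := (db B).
Local Notation rels := (sapphire_rels B).
Local Notation c1 := (r - r * u - s * t)%R.
Local Notation c2 := (s - 2 * (s * u))%R.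

Lemma theta00 : theta B 0%R 0%R = p. Proof. by rewrite mxE. Qed.
Lemma theta01 : theta B 0%R 1%R = (- 2 * (r * t))%R. Proof. by rewrite mxE. Qed.
Lemma theta10 : theta B 1%R 0%R = (- 2 * (s * u))%R. Proof. by rewrite mxE. Qed.
Lemma theta11 : theta B 1%R 1%R = p. Proof. by rewrite mxE. Qed.

(** The six relations of E for a quadruple of elements of any group, with the
inverses moved so that v and a are pushed to the right. *)
Definition sapphire_relations (G : groupType) (D Y V A : G) : Prop :=
  [/\ D * Y = Y * D,
      V * D = zexpg D p * zexpg Y (- 2 * (s * u))%R * V,
      V * Y = zexpg D (- 2 * (r * t))%R * zexpg Y p * V &
  [/\ A * A = D, A * Y = Y^-1 * A &
      A * V = zexpg D c1 * zexpg Y c2 * V^-1 * A]].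

Definition wevalE := (weval_cat, weval_winv, weval_wexp, weval1).

Lemma sapphire_rels_eval (G : groupType) (h : sapphire_gen -> G) :
  sapphire_relations (h Gd) (h Gb) (h Gv) (h Ga) <->
  forall q, q \in rels -> weval h q.1 = weval h q.2.
Proof.
split=> [[R1 R2 R3 [R4 R5 R6]] q|R].
  rewrite !inE => /or4P[|||/or3P[||]] /eqP->; rewrite /fst /snd !wevalE //.
  - by rewrite theta00 theta10 mulgA R2 mulgK.
  - by rewrite theta01 theta11 mulgA R3 mulgK.
  - by rewrite mulgA R6 mulgK.
have R' i : (i < 6)%N -> weval h (nth ([::], [::]) rels i).1
                       = weval h (nth ([::], [::]) rels i).2.
  by move=> ilt; apply/R/mem_nth.
have := (R' 0%N isT, R' 1%N isT, R' 2%N isT, R' 3%N isT, R' 4%N isT, R' 5%N isT).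
cbv [nth sapphire_rels fst snd]; rewrite !wevalE theta00 theta01 theta10 theta11.
move=> [[[[[R1 R2] R3] R4] R5] R6]; split=> //.
- by rewrite -R2 -!mulgA mulVg mulg1.
- by rewrite -R3 -!mulgA mulVg mulg1.
- by split=> //; rewrite -R6 -!mulgA mulVg mulg1.
Qed.

Lemma sapphire_relationsE : sapphire_relations d b v a.
Proof. by apply/(@sapphire_rels_eval E (pgen rels)); exact: presented_rel. Qed.

Lemma sapphire_hom (G : groupType) (D Y V A : G) :
  sapphire_relations D Y V A ->
  exists f : {multiplicative E -> G},
    [/\ f d = D, f b = Y, f v = V & f a = A].
Proof.
move=> R; pose h x := match x with Gd => D | Gb => Y | Gv => V | Ga => A end.
have [f fE] : exists f : {multiplicative E -> G}, forall x, f (pgen rels x) = h x.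
  by apply: presented_hom; apply/sapphire_rels_eval.
by exists f; split; apply: fE.
Qed.

(** The generator d does not appear because d = a^2. *)
Lemma sapphire_morph_eq (G : groupType) (f g : {multiplicative E -> G}) :
  f v = g v -> f a = g a -> f b = g b -> f =1 g.
Proof.
move=> fv fa fb; apply: presented_morph_eq; case=> //.
by have [_ _ _ [aa _ _]] := sapphire_relationsE; rewrite -[pgen _ _]aa !gmulfM fa.
Qed.

(** The translation d^x b^y.  It is sealed because associativity rewriting
would otherwise see the product inside db x y and break it up. *)
Fact tr_key : unit. Proof. exact: tt. Qed.
Definition tr (x y : int) : E := locked_with tr_key (db x y).
Lemma trE x y : tr x y = db x y. Proof. by rewrite /tr unlock. Qed.

Lemma db_comm x y : zexpg d x * zexpg b y = zexpg b y * zexpg d x.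
Proof.
have [bd _ _ _] := sapphire_relationsE.
by apply: zexpg_intertwine; symmetry; exact: zexpg_intertwine.
Qed.

Lemma trD x y x' y' : tr x y * tr x' y' = tr (x + x')%R (y + y')%R.
Proof.
rewrite !trE /Defs.db !zexpgD !mulgA; congr (_ * _); rewrite -!mulgA; congr (_ * _).
by rewrite db_comm.
Qed.

Lemma tr00 : tr 0%R 0%R = 1.
Proof. by rewrite trE /Defs.db mulg1. Qed.

Lemma trV x y : (tr x y)^-1 = tr (- x)%R (- y)%R.
Proof. by apply: (mulgI (tr x y)); rewrite trD !subrr tr00 mulgV. Qed.

Lemma tr10 : tr 1%R 0%R = d. Proof. by rewrite trE /Defs.db mulg1. Qed.
Lemma tr01 : tr 0%R 1%R = b. Proof. by rewrite trE /Defs.db mul1g. Qed.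

Lemma zexpg_tr x y n : zexpg (tr x y) n = tr (x * n)%R (y * n)%R.
Proof.
symmetry; apply: (@zexpg_unique _ (fun n => tr (x * n)%R (y * n)%R)).
  by rewrite !mulr1.
by move=> m k; rewrite trD !mulrDr.
Qed.

Lemma hom_tr (f : {multiplicative E -> E}) (a11 a12 a21 a22 : int) :
  f (tr 1%R 0%R) = tr a11 a21 -> f (tr 0%R 1%R) = tr a12 a22 ->
  forall x y, f (tr x y) = tr (a11 * x + a12 * y)%R (a21 * x + a22 * y)%R.
Proof.
move=> fd fb x y.
have -> : tr x y = zexpg (tr 1%R 0%R) x * zexpg (tr 0%R 1%R) y.
  by rewrite !zexpg_tr trD; congr tr; ring.
by rewrite gmulfM !hom_zexpg fd fb !zexpg_tr trD.
Qed.

Lemma sv_tr x y :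
  v * tr x y = tr (p * x - 2 * (r * t) * y)%R (p * y - 2 * (s * u) * x)%R * v.
Proof.
have [_ vd vb _] := sapphire_relationsE.
rewrite [in LHS]trE {1}/Defs.db mulgA (zexpg_intertwine _ vd) -mulgA.
rewrite (zexpg_intertwine _ vb) mulgA -!/(db _ _) -!trE !zexpg_tr trD.
by congr (tr _ _ * _); ring.
Qed.

Lemma sa_tr x y : a * tr x y = tr x (- y)%R * a.
Proof.
have [_ _ _ [aa ab _]] := sapphire_relationsE.
have ad : a * d = d * a by rewrite -aa mulgA.
rewrite !trE /Defs.db mulgA (zexpg_intertwine _ ad) -mulgA (zexpg_intertwine _ ab).
by rewrite zexpgVl mulgA.
Qed.

Lemma sa_sa : a * a = tr 1%R 0%R.
Proof. by have [_ _ _ [aa _ _]] := sapphire_relationsE; rewrite tr10. Qed.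

Lemma sa_sv : a * v = tr c1 c2 * v^-1 * a.
Proof. by have [_ _ _ [_ _ av]] := sapphire_relationsE; rewrite trE. Qed.

(* theta^-1 is an integral matrix because det theta = (ru - st)^2. *)
Hypothesis det1 : (r * u - s * t = 1)%R.

Lemma det_theta_eq1 : (p * p - 4 * (r * t) * (s * u) = 1)%R.
Proof.
by transitivity ((r * u - s * t) * (r * u - s * t))%R; [ring|rewrite det1].
Qed.

Lemma svV_tr x y :
  v^-1 * tr x y = tr (p * x + 2 * (r * t) * y)%R (p * y + 2 * (s * u) * x)%R * v^-1.
Proof.
apply: (mulgI v); rewrite mulgA mulgV mul1g mulgA sv_tr mulgK.
congr (tr _ _).
  by transitivity ((p * p - 4 * (r * t) * (s * u)) * x)%R; [rewrite det_theta_eq1 mul1r|ring].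
by transitivity ((p * p - 4 * (r * t) * (s * u)) * y)%R; [rewrite det_theta_eq1 mul1r|ring].
Qed.

(* The same rules inside right-associated products. *)
Lemma trDA x y x' y' g : tr x y * (tr x' y' * g) = tr (x + x')%R (y + y')%R * g.
Proof. by rewrite mulgA trD. Qed.

Lemma sv_trA x y g : v * (tr x y * g) =
  tr (p * x - 2 * (r * t) * y)%R (p * y - 2 * (s * u) * x)%R * (v * g).
Proof. by rewrite !mulgA sv_tr. Qed.

Lemma svV_trA x y g : v^-1 * (tr x y * g) =
  tr (p * x + 2 * (r * t) * y)%R (p * y + 2 * (s * u) * x)%R * (v^-1 * g).
Proof. by rewrite !mulgA svV_tr. Qed.

Lemma sa_trA x y g : a * (tr x y * g) = tr x (- y)%R * (a * g).
Proof. by rewrite !mulgA sa_tr. Qed.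

Lemma sa_svV :
  a * v^-1 = tr (2 * (r * t) * c2 - p * c1)%R (2 * (s * u) * c1 - p * c2)%R * (v * a).
Proof.
apply: (mulIg v); rewrite mulgVK -!mulgA sa_sv -!mulgA sv_trA trDA mulVKg.
by rewrite -[LHS]mul1g -tr00; congr (tr _ _ * _); ring.
Qed.

Lemma saV : a^-1 = tr (- 1)%R 0%R * a.
Proof. by apply: (mulIg a); rewrite mulVg -mulgA sa_sa trD addNr addr0 tr00. Qed.

Lemma sa_zexpg_sv k : exists x y, a * zexpg v k = tr x y * zexpg v (- k)%R * a.
Proof.
have step1 x y k' : a * zexpg v k' = tr x y * zexpg v (- k')%R * a ->
    exists x' y', a * zexpg v (1 + k')%R = tr x' y' * zexpg v (- (1 + k'))%R * a.
  rewrite zexpgS mulgA sa_sv -!mulgA => ->; rewrite svV_trA trDA.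
  by eexists; eexists; rewrite opprD zexpgD zexpgN -!mulgA.
have stepN x y k' : a * zexpg v k' = tr x y * zexpg v (- k')%R * a ->
    exists x' y', a * zexpg v (-1 + k')%R = tr x' y' * zexpg v (- (-1 + k'))%R * a.
  rewrite zexpgD (zexpgN _ 1%R) mulgA sa_svV -!mulgA => ->; rewrite sv_trA trDA.
  by eexists; eexists; rewrite opprD zexpgD opprK -!mulgA.
elim/int_rec: k => [|k [x [y IH]]|k [x [y IH]]].
- by exists 0%R, 0%R; rewrite tr00 oppr0 !mul1g mulg1.
- by rewrite -add1n PoszD; apply: step1 IH.
- have -> : (- k.+1%:Z = -1 + - k%:Z)%R by lia.
  exact: stepN IH.
Qed.

Definition sa_pow (e : bool) : E := if e then a else 1.

Lemma zexpg_sv_tr k x y : exists x' y',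
  zexpg v k * tr x y = tr x' y' * zexpg v k.
Proof.
elim/int_rec: k => [|k [x1 [y1 IH]]|k [x1 [y1 IH]]].
- by exists x, y; rewrite mul1g mulg1.
- rewrite -add1n PoszD zexpgS -!mulgA IH sv_trA.
  by eexists; eexists; reflexivity.
- have -> : (- k.+1%:Z = -1 + - k%:Z)%R by lia.
  rewrite zexpgD (zexpgN _ 1%R) -!mulgA IH svV_trA.
  by eexists; eexists; reflexivity.
Qed.

(** Words in normal form are closed under left multiplication by each letter
and its inverse. *)
Lemma normal_form g :
  exists x y k e, g = tr x y * zexpg v k * sa_pow e.
Proof.
have aM x y k e : exists x' y' k' e',
    a * (tr x y * zexpg v k * sa_pow e) = tr x' y' * zexpg v k' * sa_pow e'.
  have [x' [y' ak]] := sa_zexpg_sv k.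
  have -> : a * (tr x y * zexpg v k * sa_pow e) =
            tr (x + x')%R (- y + y')%R * zexpg v (- k)%R * (a * sa_pow e).
    by rewrite -!mulgA sa_trA [a * (zexpg _ _ * _)]mulgA ak -!mulgA trDA.
  case: e; last by rewrite /= mulg1; exists (x + x')%R, (- y + y')%R, (- k)%R, true.
  have [x1 [y1 e1]] := zexpg_sv_tr (- k)%R 1%R 0%R.
  exists (x + x' + x1)%R, (- y + y' + y1)%R, (- k)%R, false.
  by rewrite /= sa_sa mulg1 -!mulgA e1 trDA.
have trM x0 y0 x y k e : exists x' y' k' e',
    tr x0 y0 * (tr x y * zexpg v k * sa_pow e) = tr x' y' * zexpg v k' * sa_pow e'.
  by exists (x0 + x)%R, (y0 + y)%R, k, e; rewrite -!mulgA trDA.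
elim/presented_ind: g => [|[] g [x [y [k [e ->]]]]|[] g [x [y [k [e ->]]]]].
- by exists 0%R, 0%R, 0%R, false; rewrite tr00 !mulg1.
- by rewrite -[pgen _ _]/d -tr10; apply: trM.
- by rewrite -[pgen _ _]/b -tr01; apply: trM.
- rewrite -[pgen _ _]/v -!mulgA sv_trA [v * _]mulgA -zexpgS !mulgA.
  by eexists; eexists; eexists; eexists; reflexivity.
- exact: aM.
- by rewrite -[pgen _ _]/d -tr10 trV; apply: trM.
- by rewrite -[pgen _ _]/b -tr01 trV; apply: trM.
- rewrite -[pgen _ _]/v -!mulgA svV_trA [v^-1 * _]mulgA -(zexpgN _ 1%R) -zexpgD !mulgA.
  by eexists; eexists; eexists; eexists; reflexivity.
- rewrite -[pgen _ _]/a saV -[_ * _ * (_ * _)]mulgA.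
  by have [x' [y' [k' [e' ->]]]] := aM x y k e; apply: trM.
Qed.

(** * The action on Sol geometry: height and flip *)

(** The group E acts on R^2 x R: translations act on R^2, v acts by theta and
raises the third coordinate by 1, and a acts on R^2 by w |-> J w + q, where
(1 - theta^-1) q = c.  This fixed choice of q = (1/2, (u - 1) / 2t) makes
the action compatible with the relation for a v a^-1 and with a^2 = d.
Multiplying the first two coordinates by 2t makes everything integral. *)
Definition sol_letter (l : sapphire_gen * bool) (q : int * int * int) :
    int * int * int :=
  let: (x, y, z) := q in
  match l with
  | (Gd, true) => (x + 2 * t, y, z)%R
  | (Gd, false) => (x - 2 * t, y, z)%R
  | (Gb, true) => (x, y + 2 * t, z)%R
  | (Gb, false) => (x, y - 2 * t, z)%R
  | (Gv, true) => (p * x - 2 * (r * t) * y, p * y - 2 * (s * u) * x, 1 + z)%R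
  | (Gv, false) => (p * x + 2 * (r * t) * y, p * y + 2 * (s * u) * x, z - 1)%R
  | (Ga, true) => (x + t, u - 1 - y, - z)%R
  | (Ga, false) => (x - t, u - 1 - y, - z)%R
  end.

Definition sol_word (w : word sapphire_gen) : int * int * int -> int * int * int :=
  \big[@fcomp _/id]_(l <- w) sol_letter l.

Definition sol (g : E) := sol_word (repr (g : {eq_quot _})).

Lemma sol_word_cat w1 w2 q : sol_word (w1 ++ w2) q = sol_word w1 (sol_word w2 q).
Proof. by rewrite /sol_word big_cat. Qed.

Lemma sol_word1 l q : sol_word [:: l] q = sol_letter l q.
Proof. by rewrite /sol_word big_cons big_nil. Qed.

Lemma sol_wexp_d n x y z : sol_word (wexp Gd n) (x, y, z) = (x + 2 * t * n, y, z)%R.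
Proof.
have E e m : sol_word (nseq m (Gd, e)) (x, y, z) =
    (x + (if e then 2 * t else - (2 * t)) * m%:Z, y, z)%R.
  elim: m => [|m IH]; first by rewrite /sol_word big_nil mulr0 addr0.
  rewrite [nseq _ _]/= -cat1s sol_word_cat IH sol_word1 /=.
  by case: e {IH}; congr (_, _, _); rewrite -(addn1 m) PoszD; ring.
by case: n => n; rewrite /wexp E //; congr (_, _, _); rewrite NegzE; ring.
Qed.

Lemma sol_wexp_b n x y z : sol_word (wexp Gb n) (x, y, z) = (x, y + 2 * t * n, z)%R.
Proof.
have E e m : sol_word (nseq m (Gb, e)) (x, y, z) =
    (x, y + (if e then 2 * t else - (2 * t)) * m%:Z, z)%R.
  elim: m => [|m IH]; first by rewrite /sol_word big_nil mulr0 addr0.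
  rewrite [nseq _ _]/= -cat1s sol_word_cat IH sol_word1 /=.
  by case: e {IH}; congr (_, _, _); rewrite -(addn1 m) PoszD; ring.
by case: n => n; rewrite /wexp E //; congr (_, _, _); rewrite NegzE; ring.
Qed.

Definition solE := (sol_word_cat, sol_word1, sol_wexp_d, sol_wexp_b).

(** Words that represent the same element act in the same way, since the maps
attached to the letters satisfy the six relations of E. *)
Lemma sol_class w : sol (class_of_word rels w) = sol_word w.
Proof.
apply: (@word_eqv_fold _ rels).
- move=> [] [] /=; apply: funext => -[[x y] z]; rewrite /fcomp /=;
    congr (_, _, _); try ring.
  + by apply: (eq_comb (c := ((r * u - s * t + 1) * x)%R) det1); ring.
  + by apply: (eq_comb (c := ((r * u - s * t + 1) * y)%R) det1); ring.
  + by apply: (eq_comb (c := ((r * u - s * t + 1) * x)%R) det1); ring.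
  + by apply: (eq_comb (c := ((r * u - s * t + 1) * y)%R) det1); ring.
- move=> q; rewrite !inE => /or4P[|||/or3P[||]] /eqP->; rewrite /fst /snd;
  apply: funext => -[[x y] z]; rewrite -!/(sol_word _) !solE /=.
  + by [].
  + rewrite theta00 theta10; congr (_, _, _); try ring.
    * by apply: (eq_comb (c := ((r * u - s * t + 1) * x)%R) det1); ring.
    * by apply: (eq_comb (c := ((r * u - s * t + 1) * y)%R) det1); ring.
  + rewrite theta01 theta11; congr (_, _, _); try ring.
    * by apply: (eq_comb (c := ((r * u - s * t + 1) * x)%R) det1); ring.
    * by apply: (eq_comb (c := ((r * u - s * t + 1) * y)%R) det1); ring.
  + by congr (_, _, _); ring.
  + by congr (_, _, _); ring.
  + congr (_, _, _); try ring.
    * by apply: (eq_comb (c := (- t)%R) det1); ring.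
    * by apply: (eq_comb (c := (1 - u)%R) det1); ring.
- by apply/class_of_wordP; rewrite class_of_wordK.
Qed.

Lemma solM g h q : sol (g * h) q = sol g (sol h q).
Proof.
by rewrite -[g]class_of_wordK -[h]class_of_wordK -class_of_wordM !sol_class
  sol_word_cat.
Qed.

Lemma sol_tr m n x y z :
  sol (tr m n) (x, y, z) = (x + 2 * t * m, y + 2 * t * n, z)%R.
Proof.
have wE w : class_of_word rels w = weval (pgen rels) w by exact: class_of_word_weval.
by rewrite trE /Defs.db -!(weval_wexp (pgen rels)) -weval_cat -wE sol_class !solE.
Qed.

Lemma sol_pgen x e q :
  sol (if e then pgen rels x else (pgen rels x)^-1) q = sol_letter (x, e) q.
Proof.
by case: e; rewrite /pgen -?class_of_wordV sol_class sol_word1.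
Qed.

(** On the third coordinate E acts by the isometries z |-> k + e z of Z, with
e = 1 or -1, that is, through the infinite dihedral group. *)
Lemma sol_height g : exists e k, (e = 1 \/ e = - 1)%R /\
  forall x y z, (sol g (x, y, z)).2 = (k + e * z)%R.
Proof.
have step x b' g' : (exists e k, (e = 1 \/ e = - 1)%R /\
      forall x y z, (sol g' (x, y, z)).2 = (k + e * z)%R) ->
    exists e k, (e = 1 \/ e = - 1)%R /\
      forall y y' z, (sol ((if b' then pgen rels x else (pgen rels x)^-1) * g')
                     (y, y', z)).2 = (k + e * z)%R.
  move=> [e [k [e1 gE]]].
  exists (if x is Ga then - e else e)%R.
  exists (match x with Ga => - k | Gv => if b' then 1 + k else k - 1 | _ => k end)%R.
  split; first by case: x => //; case: e1 => ->; rewrite ?opprK; auto.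
  move=> y y' z; rewrite solM sol_pgen.
  have := gE y y' z; case: (sol g' _) => -[x1 x2] x3 /= ->.
  by case: x; case: b' => //=; ring.
elim/presented_ind: g => [|x g IH|x g IH]; first exists 1%R, 0%R.
- split=> [|x y z]; first by left.
  by have := sol_tr 0 0 x y z; rewrite tr00 => ->; ring.
- exact: (step x true).
- exact: (step x false).
Qed.

Definition height (g : E) : int := (sol g (0, 0, 0)%R).2.
Definition flip (g : E) : int := ((sol g (0, 0, 1)%R).2 - height g)%R.

Lemma flip_sign g : (flip g = 1 \/ flip g = - 1)%R.
Proof.
have [e [k [e1 E]]] := sol_height g; rewrite /flip /height !E.
by have -> : (k + e * 1 - (k + e * 0) = e)%R by ring.
Qed.

Lemma height_flipM g h : (height (g * h) = height g + flip g * height h)%R /\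
  (flip (g * h) = flip g * flip h)%R.
Proof.
have E g' : exists e k, forall q, (sol g' q).2 = (k + e * q.2)%R.
  have [e [k [_ E]]] := sol_height g'.
  by exists e, k => -[[x y] z]; exact: E.
have [[e [k Eg]] [e' [k' Eh]]] := (E g, E h).
by rewrite /flip /height !solM !Eg !Eh /=; split; ring.
Qed.

Lemma heightM g h : height (g * h) = (height g + flip g * height h)%R.
Proof. by have [] := height_flipM g h. Qed.

Lemma flipM g h : flip (g * h) = (flip g * flip h)%R.
Proof. by have [] := height_flipM g h. Qed.

Lemma height_tr x y : height (tr x y) = 0%R.
Proof. by rewrite /height sol_tr. Qed.
Lemma flip_tr x y : flip (tr x y) = 1%R.
Proof. by rewrite /flip height_tr sol_tr. Qed.
Lemma height1 : height 1 = 0%R. Proof. by rewrite -tr00 height_tr. Qed.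
Lemma flip1 : flip 1 = 1%R. Proof. by rewrite -tr00 flip_tr. Qed.
Lemma height_v : height v = 1%R.
Proof. by rewrite /height (sol_pgen Gv true). Qed.
Lemma flip_v : flip v = 1%R.
Proof. by rewrite /flip height_v (sol_pgen Gv true). Qed.
Lemma height_a : height a = 0%R.
Proof. by rewrite /height (sol_pgen Ga true). Qed.
Lemma flip_a : flip a = (- 1)%R.
Proof. by rewrite /flip height_a (sol_pgen Ga true). Qed.

Lemma flipV g : flip g^-1 = flip g.
Proof.
have := flipM g g^-1; rewrite mulgV flip1.
by case: (flip_sign g) => ->; case: (flip_sign g^-1) => ->.
Qed.

Lemma heightV g : height g^-1 = (- (flip g * height g))%R.
Proof.
have := heightM g^-1 g; rewrite mulVg height1 flipV => /esym/eqP.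
by rewrite addr_eq0 => /eqP.
Qed.

Lemma height_zexpg g k : flip g = 1%R -> height (zexpg g k) = (height g * k)%R.
Proof.
move=> g1; elim/int_rec: k => [|k IH|k IH]; first by rewrite height1 mulr0.
  by rewrite -add1n PoszD zexpgS heightM IH g1; ring.
have -> : (- k.+1%:Z = -1 + - k%:Z)%R by lia.
by rewrite zexpgD (zexpgN _ 1%R) heightM heightV flipV IH zexpg1 g1; ring.
Qed.

Lemma flip_zexpg g k : flip g = 1%R -> flip (zexpg g k) = 1%R.
Proof.
have E n : flip g = 1%R -> flip (g ^+ n) = 1%R.
  by move=> g1; elim: n => [|n IH]; rewrite ?flip1 // expgS flipM g1 IH.
by case: k => n g1; rewrite /= ?flipV E.
Qed.

(** The kernel of the homomorphism to the infinite dihedral group is the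
lattice of translations. *)
Lemma tr_ker g : flip g = 1%R -> height g = 0%R -> exists x y, g = tr x y.
Proof.
have [x [y [k [e ->]]]] := normal_form g.
rewrite !flipM flip_tr flip_zexpg ?flip_v //.
case: e => /=; first by rewrite flip_a.
rewrite mulg1 heightM height_tr flip_tr height_zexpg ?flip_v // height_v => _.
by rewrite add0r !mul1r => ->; exists x, y; rewrite mulg1.
Qed.

Lemma tr_v_form g : flip g = 1%R -> exists x y, g = tr x y * zexpg v (height g).
Proof.
move=> g1; have [||x [y e]] := @tr_ker (g * zexpg v (- height g)%R).
- by rewrite flipM g1 flip_zexpg ?flip_v.
- by rewrite heightM g1 height_zexpg ?flip_v // height_v; ring.
by exists x, y; rewrite -e zexpgN mulgVK.
Qed.

Lemma tr_v_a_form g : flip g = (- 1)%R ->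
  exists x y, g = tr x y * zexpg v (height g) * a.
Proof.
move=> g1; have [|x [y e]] := @tr_v_form (g * a^-1).
  by rewrite flipM g1 flipV flip_a.
exists x, y; move: e; rewrite heightM heightV height_a mulr0 oppr0 mulr0 addr0.
by move/(canRL (mulgVK _)).
Qed.

Hypothesis rstu0 : (r * s * t * u != 0)%R.

Lemma t0 : (t != 0)%R.
Proof. by apply: contraNneq rstu0 => ->; rewrite mulr0 mul0r. Qed.

Lemma u0 : (u != 0)%R.
Proof. by apply: contraNneq rstu0 => ->; rewrite mulr0. Qed.

Lemma r0 : (r != 0)%R.
Proof. by apply: contraNneq rstu0 => ->; rewrite !mul0r. Qed.

Lemma s0 : (s != 0)%R.
Proof. by apply: contraNneq rstu0 => ->; rewrite mulr0 !mul0r. Qed.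

Lemma tr_inj x y x' y' : tr x y = tr x' y' -> x = x' /\ y = y'.
Proof.
move=> e; have := sol_tr x y 0 0 0; rewrite e sol_tr !add0r => -[].
have t2 : (2 * t != 0)%R by have := t0; lia.
by move=> /(mulfI t2) -> /(mulfI t2) ->.
Qed.

Lemma subDBP g : subDB g <-> flip g = 1%R /\ height g = 0%R.
Proof.
split=> [|[g1 g0]].
  elim=> {g}; [move=> g [->|->]| | |].
  - by rewrite -tr10 height_tr flip_tr.
  - by rewrite -tr01 height_tr flip_tr.
  - by rewrite flip1 height1.
  - by move=> g h _ [g1 g0] _ [h1 h0]; rewrite flipM heightM g1 g0 h1 h0.
  - by move=> g _ [g1 g0]; rewrite flipV heightV g0 mulr0.
have [x [y ->]] := tr_ker g1 g0; rewrite trE.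
by apply: generatedM; apply: generated_zexpg; apply: generated_in; auto.
Qed.

Lemma subDBVP g : subDBV g <-> flip g = 1%R.
Proof.
split=> [|g1].
  elim=> {g}; [move=> g [->|->|->]| | |].
  - by rewrite -tr10 flip_tr.
  - by rewrite -tr01 flip_tr.
  - exact: flip_v.
  - exact: flip1.
  - by move=> g h _ g1 _ h1; rewrite flipM g1 h1.
  - by move=> g _ g1; rewrite flipV.
have [x [y ->]] := tr_v_form g1; rewrite trE.
apply: generatedM; last by apply: generated_zexpg; apply: generated_in; constructor 3.
by apply: generatedM; apply: generated_zexpg; apply: generated_in;
  [constructor 1|constructor 2].
Qed.

(** * The characteristic subgroups *)

(* disc is p^2 - 1, the discriminant of theta up to a factor 4. *)
Local Notation disc := (4 * (r * t) * (s * u))%R.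

(** This is the hyperbolicity of theta: with q = st it equals 4 q (1 + q), and
the integers q and 1 + q = ru are both nonzero. *)
Lemma disc_gt0 : (0 < disc)%R.
Proof.
have -> : disc = (4 * ((s * t) * (1 + s * t)))%R.
  by rewrite -det1; ring.
have st0 : (s * t != 0)%R by rewrite mulf_neq0 ?s0 ?t0.
have ru0 : (1 + s * t != 0)%R.
  rewrite -det1 addrNK; apply: contraNneq rstu0 => ru0.
  by transitivity (s * t * (r * u) == 0)%R; [congr (_ == _)%R; ring|rewrite ru0 mulr0].
move: (s * t)%R st0 ru0 => q; nia.
Qed.

Lemma p_neq0 : (p != 0)%R.
Proof.
by apply/eqP => p0; have := det_theta_eq1; have := disc_gt0; rewrite p0 mul0r; lia.
Qed.

(** The powers of theta lie in Z[theta]: theta^k has diagonal entries P and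
off-diagonal entries -2rtQ and -2suQ, where P + Q sqrt(disc) is the k-th power
of p + sqrt(disc), a unit of norm 1.  For k > 0 the product p P Q stays
positive, whatever the sign of p, so Q does not vanish. *)
Lemma zexpg_sv_action k : exists P Q,
  [/\ (P * P - disc * (Q * Q) = 1)%R,
      (0 <= k -> 0 <= p * (P * Q))%R, (0 < k -> 0 < p * (P * Q))%R
    & forall x y, zexpg v k * tr x y =
        tr (P * x - 2 * (r * t) * Q * y)%R (P * y - 2 * (s * u) * Q * x)%R * zexpg v k].
Proof.
have T := det_theta_eq1.
elim/int_rec: k => [|k [P [Q [N Q0 _ E]]]|k [P [Q [N _ _ E]]]].
- exists 1%R, 0%R; split=> [|||x y] //; [by ring|by rewrite !mulr0|].
  by rewrite mul1g mulg1; congr tr; ring.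
- exists (p * P + disc * Q)%R, (p * Q + P)%R.
  have pos : (0 < p * ((p * P + disc * Q) * (p * Q + P)))%R.
    have -> : (p * ((p * P + disc * Q) * (p * Q + P)) =
      (p * p + disc) * (p * (P * Q)) + (p * p) * (P * P + disc * (Q * Q)))%R by ring.
    have pp : (0 < p * p)%R by rewrite -expr2 exprn_even_gt0 //= p_neq0.
    have := Q0 isT; have := disc_gt0; move: (p * (P * Q))%R => w.
    move: N pp; clear; move: disc (p * p)%R => D e N e0 D0 w0.
    have DQ : (0 <= D * (Q * Q))%R.
      by apply: mulr_ge0; [exact: ltW|rewrite -expr2 sqr_ge0].
    have PP : (0 < P * P + D * (Q * Q))%R by lia.
    apply: ltr_wpDl; last exact: mulr_gt0.
    by apply: mulr_ge0 => //; apply: addr_ge0; exact: ltW.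
  split=> [|_|_|x y]; [|exact: ltW|done|].
  + by transitivity ((p * p - disc) * (P * P - disc * (Q * Q)))%R; [ring|rewrite T N].
  + rewrite -add1n PoszD zexpgS -!mulgA E sv_trA; congr (tr _ _ * _); ring.
- exists (p * P - disc * Q)%R, (p * Q - P)%R; split=> // [|x y].
  + by transitivity ((p * p - disc) * (P * P - disc * (Q * Q)))%R; [ring|rewrite T N].
  + have -> : (- k.+1%:Z = -1 + - k%:Z)%R by lia.
    rewrite zexpgD (zexpgN _ 1%R) -!mulgA E svV_trA; congr (tr _ _ * _); ring.
Qed.

(** Equivalently, the normal closure of g is abelian. *)
Definition self_commuting (G : groupType) (g : G) :=
  forall h, commute g (h * g * h^-1).

Lemma self_commutingV (G : groupType) (g : G) :
  self_commuting g -> self_commuting g^-1.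
Proof.
move=> gC h; have := gC h; rewrite /commute => /(congr1 (fun x : G => x^-1)).
by rewrite !invgM !invgK !mulgA => ->.
Qed.

Lemma self_commuting_aut (G : groupType) (phi : aut G) g :
  self_commuting (phi g) <-> self_commuting g.
Proof.
split=> gC h.
  apply: (bij_inj (aut_bij phi)); have := gC (phi h); rewrite /commute.
  by rewrite !autM !autV.
have [h' <-] := aut_surj phi h; have := gC h'; rewrite /commute => /(congr1 phi).
by rewrite !autM !autV.
Qed.

(** Conjugating g by the translation z multiplies it by the translation
(1 - R) z, where R is the action of g on translations; commutation with g then
says R (1 - R) z = (1 - R) z. *)
Lemma self_commuting_action g (a11 a12 a21 a22 : int) :
  (forall x y, g * tr x y = tr (a11 * x + a12 * y)%R (a21 * x + a22 * y)%R * g) ->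
  self_commuting g -> forall x y,
  let m := (x - (a11 * x + a12 * y))%R in let n := (y - (a21 * x + a22 * y))%R in
  (a11 * m + a12 * n = m)%R /\ (a21 * m + a22 * n = n)%R.
Proof.
move=> gE gC x y m n; have := gC (tr x y).
have -> : tr x y * g * (tr x y)^-1 = tr m n * g.
  by rewrite trV -mulgA gE trDA; congr (tr _ _ * _); rewrite /m /n; ring.
by rewrite /commute mulgA gE -!mulgA => /mulIg/tr_inj.
Qed.

(** For g of positive height k, (1 - theta^k)^2 = 0 gives
(P - 1)^2 + disc Q^2 = 0, hence Q = 0, a contradiction; negative heights reduce
to this case by inversion.  For a reflection R, R^2 = 1 turns (1 - R)^2 = 0
into R = 1, while the diagonal entries of R are P and -P. *)
Lemma subDB_self_commuting (g : E) : subDB g <-> self_commuting g.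
Proof.
split=> [/subDBP[g1 g0] h|gC].
  have [x [y ->]] := tr_ker g1 g0.
  have [||x' [y' ->]] := @tr_ker (h * tr x y * h^-1).
  - by rewrite !flipM flip_tr flipV mulr1; case: (flip_sign h) => ->.
  - rewrite !heightM heightV height_tr flipM flip_tr.
    by case: (flip_sign h) => ->; ring.
  by rewrite /commute !trD ![(x' + _)%R]addrC ![(y' + _)%R]addrC.
have D0 := disc_gt0.
have neg g' : self_commuting g' -> flip g' = 1%R -> (0 < height g')%R -> False.
  move=> {}gC g1 g0; have [x [y e]] := tr_v_form g1.
  have [P [Q [N _ pos E]]] := zexpg_sv_action (height g').
  have Eg x' y' : g' * tr x' y' =
      tr (P * x' + (- (2 * (r * t) * Q)) * y')%R
         ((- (2 * (s * u) * Q)) * x' + P * y')%R * g'.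
    by rewrite {1}e -mulgA E mulgA trD {2}e mulgA trD; congr (tr _ _ * _); ring.
  have [c _] := self_commuting_action Eg gC 1 0.
  have Q0 : (Q = 0)%R.
    have /eqP : ((P - 1) * (P - 1) + disc * (Q * Q) = 0)%R.
      by apply: (eq_comb (c := (-1)%R) c); ring.
    have sq (z : int) : (0 <= z * z)%R by rewrite -expr2 sqr_ge0.
    rewrite paddr_eq0 //; last exact/mulr_ge0/sq/ltW.
    move=> /andP[_].
    by rewrite mulf_eq0 gt_eqF //= mulf_eq0 orbb => /eqP.
  by have := pos g0; rewrite Q0 !mulr0.
apply/subDBP; case: (flip_sign g) => g1.
  split=> //; have [] := @ltgtP _ _ (height g) 0%R => // g0.
  - by case: (neg g^-1); rewrite ?flipV ?heightV ?g1 ?mul1r ?oppr_gt0 //;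
      exact: self_commutingV.
  - by case: (neg g).
have [x [y e]] := tr_v_a_form g1.
have [P [Q [N _ _ E]]] := zexpg_sv_action (height g).
have Eg x' y' : g * tr x' y' =
    tr (P * x' + (2 * (r * t) * Q) * y')%R
       ((- (2 * (s * u) * Q)) * x' + (- P) * y')%R * g.
  rewrite {1}e -!mulgA sa_tr [zexpg _ _ * _]mulgA E -!mulgA trDA {2}e -!mulgA trDA.
  by congr (tr _ _ * _); ring.
have [c1' _] := self_commuting_action Eg gC 1 0.
have [_ c2'] := self_commuting_action Eg gC 0 1.
have P1 : (2 * P - 1 = P * P - disc * (Q * Q))%R.
  by apply: (eq_comb (c := 1%R) c1'); ring.
have P2 : (- 2 * P - 1 = P * P - disc * (Q * Q))%R.
  by apply: (eq_comb (c := 1%R) c2'); ring.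
by move: P1 P2; rewrite N; clear; lia.
Qed.

(** An element outside <d,b,v> acts on Z as a reflection, so its square has
height 0; an element of <d,b,v> of height k <> 0 has a square of height 2k. *)
Lemma subDBV_sq (g : E) : subDBV g <-> subDB g \/ ~ subDB (g * g).
Proof.
split=> [/subDBVP g1|].
  have [g0|g0] := eqVneq (height g) 0%R; [left; exact/subDBP|right].
  by move/subDBP; rewrite heightM g1 mul1r => -[_]; lia.
case=> [/subDBP[g1 _]|gg]; apply/subDBVP => //.
case: (flip_sign g) => // g1; case: gg; apply/subDBP.
by rewrite flipM heightM g1; split; [|ring].
Qed.

Lemma subDB_aut (phi : AutE B) g : subDB (phi g) <-> subDB g.
Proof.
by split=> /subDB_self_commuting H; apply/subDB_self_commuting;
  apply/(self_commuting_aut phi).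
Qed.

Lemma subDBV_aut (phi : AutE B) g : subDBV (phi g) <-> subDBV g.
Proof.
have := subDB_aut phi g; have := subDB_aut phi (g * g); rewrite autM => e1 e2.
split=> /subDBV_sq[H|H]; apply/subDBV_sq; [left|right|left|right]; tauto.
Qed.

Lemma aut_acts (phi : AutE B) : acts_on_quotient phi.
Proof. by split; [exact: subDB_aut|exact: subDBV_aut]. Qed.

Lemma flip_aut (phi : AutE B) g : flip (phi g) = flip g.
Proof.
have [H1 H2] : flip (phi g) = 1%R <-> flip g = 1%R.
  by split=> /subDBVP/subDBV_aut/subDBVP.
case: (flip_sign g) => g1; first by rewrite g1 (H2 g1).
by case: (flip_sign (phi g)) => e; [rewrite e (H1 e)|rewrite e g1].
Qed.

Lemma tr_aut (phi : AutE B) x y : exists x' y', phi (tr x y) = tr x' y'.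
Proof.
have /subDBP[] : subDB (phi (tr x y)).
  by apply/subDB_aut/subDBP; rewrite flip_tr height_tr.
exact: tr_ker.
Qed.

(** * The sign of an automorphism *)

(** The scalar by which phi acts on <d,b,v>/<d,b> = Z. *)
Definition slope (phi : AutE B) : int := height (phi v).

Lemma height_aut (phi : AutE B) g :
  flip g = 1%R -> height (phi g) = (slope phi * height g)%R.
Proof.
move=> g1; have [x [y {1}->]] := tr_v_form g1; have [x' [y' e]] := tr_aut phi x y.
rewrite autM e aut_zexpg heightM height_tr flip_tr height_zexpg ?flip_aut ?flip_v //.
by rewrite add0r mul1r.
Qed.

Lemma slopeM (phi psi : AutE B) : slope (phi * psi) = (slope phi * slope psi)%R.
Proof. by rewrite -[RHS]height_aut // flip_aut flip_v. Qed.

Lemma slope1 : slope 1 = 1%R.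
Proof. exact: height_v. Qed.

Lemma slope_sign (phi : AutE B) : (slope phi = 1 \/ slope phi = - 1)%R.
Proof.
by apply: (@int_unit _ (slope phi^-1)); rewrite -slopeM mulgV slope1.
Qed.

Lemma typeIP (phi : AutE B) : typeI phi <-> slope phi = 1%R.
Proof.
split=> [[_ /(_ v)]|s1].
  move=> /(_ (proj2 (subDBVP v) flip_v)).
  by case/subDBP => _; rewrite heightM flip_aut flip_v heightV flip_v height_v /slope; lia.
split; first exact: aut_acts.
move=> x /subDBVP x1; apply/subDBP.
by rewrite flipM heightM flip_aut flipV heightV height_aut // x1 s1; split; [|ring].
Qed.

Lemma typeIIP (phi : AutE B) : typeII phi <-> slope phi = (- 1)%R.
Proof.
split=> [[_ /(_ v)]|s1].
  move=> /(_ (proj2 (subDBVP v) flip_v)).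
  by case/subDBP => _; rewrite heightM flip_aut flip_v height_v /slope; lia.
split; first exact: aut_acts.
move=> x /subDBVP x1; apply/subDBP.
by rewrite flipM heightM flip_aut height_aut // x1 s1; split; [|ring].
Qed.

Lemma Aut_signE (phi : AutE B) :
  Aut_sign phi = if slope phi == 1%R then 1 else genZ2.
Proof.
rewrite /Aut_sign; case: asboolP => [/typeIIP ->|nII] //.
by case: (slope_sign phi) => [->|/typeIIP] //.
Qed.

Lemma Aut_signM : {morph (@Aut_sign B) : phi psi / phi * psi}.
Proof.
move=> phi psi; rewrite !Aut_signE slopeM.
by case: (slope_sign phi) => ->; case: (slope_sign psi) => ->;
  rewrite /= ?mul1g ?mulg1 ?genZ2_sqr.
Qed.

Lemma Aut_sign_eq1 (phi : AutE B) : Aut_sign phi = 1 <-> slope phi = 1%R.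
Proof. by rewrite Aut_signE; case: eqP. Qed.

Lemma Aut0_incl_slope (phi : Aut0 B) : slope (Aut0_incl phi) = 1%R.
Proof. by apply/typeIP; have := valP phi; rewrite inE => /asboolP. Qed.

Lemma Aut0_incl_onto (phi : AutE B) :
  slope phi = 1%R -> exists psi : Aut0 B, Aut0_incl psi = phi.
Proof.
move=> /typeIP H; have I : phi \in @Aut0_pred B by rewrite inE; apply/asboolP.
by exists (exist _ phi I).
Qed.

Lemma Aut0_inclM : {morph (@Aut0_incl B) : phi psi / phi * psi}.
Proof. by []. Qed.

HB.instance Definition _ :=
  isMultiplicative.Build (Aut0 B) (AutE B) (@Aut0_incl B) Aut0_inclM.

Lemma Aut0_incl_inj : injective (@Aut0_incl B).
Proof. exact: val_inj. Qed.

(** * The involution zeta *)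

Local Notation h1 := (r - r * u)%R.
Local Notation h2 := (s - s * u)%R.

Lemma zeta_relations :
  sapphire_relations (tr 1%R 0%R) (tr 0%R (- 1)%R) (tr h1 h2 * v^-1) a.
Proof.
split; first by rewrite !trD.
- rewrite !zexpg_tr trD -mulgA svV_tr !mulgA !trD; congr (tr _ _ * _); ring.
- rewrite !zexpg_tr trD -mulgA svV_tr !mulgA !trD; congr (tr _ _ * _); ring.
split; [exact: sa_sa| |].
  by rewrite trV sa_tr oppr0.
rewrite !zexpg_tr !trD invgM invgK trV sa_trA sa_svV -!mulgA sv_trA !trDA.
congr (tr _ _ * _).
- by apply: (eq_comb (c := (- (s * t))%R) det1); ring.
- by apply: (eq_comb (c := (s * u)%R) det1); ring.
Qed.

Lemma zeta_exists : exists zeta : AutE B,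
  [/\ is_zeta zeta, slope zeta = (- 1)%R & zeta * zeta = 1].
Proof.
have [f [fd fb fv fa]] := sapphire_hom zeta_relations.
have f_tr x y : f (tr x y) = tr x (- y)%R.
  rewrite (hom_tr (etrans (congr1 f tr10) fd) (etrans (congr1 f tr01) fb)).
  by congr tr; ring.
have ff : f \o f =1 idfun.
  apply: (@sapphire_morph_eq _ (f \o f) idfun) => /=.
  - rewrite fv gmulfM homV fv f_tr invgM invgK trV sv_tr mulgA trD.
    rewrite -[RHS]mul1g -tr00; congr (tr _ _ * _).
      by apply: (eq_comb (c := (- h1)%R) det1); ring.
    by apply: (eq_comb (c := h2) det1); ring.
  - by rewrite !fa.
  - by rewrite fb f_tr opprK tr01.
have f_aut : is_aut f by apply/asboolP; split; [exact: gmulfM|exists f].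
exists (Aut f_aut); split; last exact: aut_ext.
- split=> [x y||] //=; first by rewrite -!trE f_tr.
  by rewrite fv trE.
- by rewrite /slope /= fv heightM height_tr flip_tr heightV height_v flip_v.
Qed.

(** * Automorphisms of slope 1 that preserve the height of a *)

(** These automorphisms act on the lattice by a sign, negative when e holds,
and are described by the translation parts of the images of a and v.  For each
sign these form a coset of a lattice with coordinates n and z; the base point
n = z = 0 is the identity when e is false, and an involution when e is true. *)
Section Translations.
Variables (e : bool) (n z : int).

Definition kernel_sign : int := if e then (- 1)%R else 1%R.
Definition a_shift : E := tr (if e then (- 1)%R else 0%R) n.
Definition v_shift : E :=
  tr ((if e then 1 - r else 0) + t * z)%R ((if e then s else 0) + n - u * z)%R.

Lemma kernel_relations :
  sapphire_relations (tr kernel_sign 0%R) (tr 0%R kernel_sign)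
    (v_shift * v) (a_shift * a).
Proof.
rewrite /v_shift /a_shift; split; first by rewrite !trD !addr0 !add0r.
- rewrite !zexpg_tr trD -mulgA sv_tr !mulgA !trD; congr (tr _ _ * _); ring.
- rewrite !zexpg_tr trD -mulgA sv_tr !mulgA !trD; congr (tr _ _ * _); ring.
split.
- rewrite -!mulgA sa_trA sa_sa !trD /kernel_sign; case: e; congr tr; ring.
- rewrite trV -mulgA sa_tr !mulgA !trD; congr (tr _ _ * _); ring.
rewrite !zexpg_tr !trD invgM trV -!mulgA sa_trA sa_sv -!mulgA !trDA svV_trA trDA.
rewrite /kernel_sign; case: e; congr (tr _ _ * _).
- by apply: (eq_comb (c := (- (t * z) - r)%R) det1); ring.
- by apply: (eq_comb (c := (- (u * z) - s)%R) det1); ring.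
- by apply: (eq_comb (c := (- (t * z))%R) det1); ring.
- by apply: (eq_comb (c := (- (u * z))%R) det1); ring.
Qed.

End Translations.

Definition kernel_datum (e : bool) (n z : int) (f : E -> E) : Prop :=
  [/\ f b = tr 0%R (kernel_sign e), f v = v_shift e n z * v & f a = a_shift e n * a].

(** When phi has type I, phi(a) = d^m b^n v^k a and the rise of phi is k. *)
Definition rise (phi : AutE B) : int := height (phi a).

Lemma riseM (phi psi : AutE B) :
  slope phi = 1%R -> rise (phi * psi) = (rise phi + rise psi)%R.
Proof.
move=> s1; rewrite /rise.
have y1 : flip (psi a * a^-1) = 1%R by rewrite flipM flip_aut flipV flip_a.
have -> : (phi * psi) a = phi (psi a * a^-1) * phi a.
  by rewrite -autM mulgVK.
rewrite heightM height_aut // flip_aut y1 s1 heightM heightV height_a; ring.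
Qed.

Lemma Aut0kP k (phi : Aut0 B) : Aut0k k phi <-> rise (Aut0_incl phi) = k.
Proof.
rewrite /Aut0k /rise; split=> [[m [n ->]]|<-].
  rewrite -trE !heightM height_tr flip_tr height_a height_zexpg ?flip_v // height_v.
  ring.
have [|x [y e]] := @tr_v_a_form (Aut0_incl phi a); first by rewrite flip_aut flip_a.
by exists x, y; rewrite -trE.
Qed.

(** Conjugation by v: v a v^-1 is a translation times v^2 a. *)
Lemma rise_inner_v : exists phi : Aut0 B, rise (Aut0_incl phi) = 2%R.
Proof.
have c_aut : is_aut (fun x : E => v * x * v^-1).
  apply/asboolP; split=> [x y|]; first by rewrite !mulgA mulgVK.
  by exists (fun x => v^-1 * x * v) => x; rewrite !mulgA ?mulgK ?mulgVK
    ?mulVg ?mulgV mul1g.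
have [|phi e] := @Aut0_incl_onto (Aut c_aut).
  by rewrite /slope /= mulgK height_v.
exists phi; rewrite e /rise /= !heightM heightV flipM flip_v flip_a height_v height_a.
ring.
Qed.

(** Applying phi to the relations: a b = b^-1 a makes phi(b) a power of b;
a^2 = d makes phi(d) a power of d; the relation for v d equates the two
exponents, since su <> 0; and bijectivity makes the exponent a sign.  The
relation for a v then becomes a single equation u X = t Y for the translation
parts, because J + theta^-1 = 2 (r, s)^T (u, t) has rank one.  As ru - st = 1,
its solutions are X = t z, Y = u z with z = r Y - s X. *)
Lemma kernel_classification (phi : AutE B) :
  slope phi = 1%R -> rise phi = 0%R ->
  exists e n z, kernel_datum e n z phi.
Proof.
move=> s1 rise0.
have [g1 [g2 fa]] : exists x y, phi a = tr x y * a.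
  have [|x [y]] := @tr_v_a_form (phi a); first by rewrite flip_aut flip_a.
  by rewrite -/(rise phi) rise0 mulg1 => ->; exists x, y.
have [w1 [w2 fv]] : exists x y, phi v = tr x y * v.
  have [|x [y]] := @tr_v_form (phi v); first by rewrite flip_aut flip_v.
  by rewrite -/(slope phi) s1 zexpg1 => ->; exists x, y.
have [al [ga fd]] := tr_aut phi 1%R 0%R.
have [be [de fb]] := tr_aut phi 0%R 1%R.
have f_tr x y : phi (tr x y) = tr (al * x + be * y)%R (ga * x + de * y)%R.
  exact: (hom_tr fd fb).
have be0 : be = 0%R.
  have := congr1 phi (sa_tr 0%R 1%R).
  rewrite !autM fa !f_tr -!mulgA sa_tr !mulgA !trD => /mulIg/tr_inj[e _].
  by move: e; clear; lia.
have [alE ga0] : (al = 1 + 2 * g1)%R /\ ga = 0%R.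
  apply: tr_inj; rewrite -fd -sa_sa autM fa -!mulgA sa_trA sa_sa !trD; congr tr; ring.
have {}fb : phi b = tr 0%R de by rewrite -tr01 fb be0.
have de_al : de = al.
  have := congr1 phi (sv_tr 1%R 0%R); rewrite !autM fv !f_tr be0 ga0 -!mulgA sv_tr !mulgA.
  rewrite !trD => /mulIg/tr_inj[_ e].
  have su : (s * u != 0)%R by rewrite mulf_neq0 ?s0 ?u0.
  apply: (mulfI su); apply: (mulfI (isT : 2%:R != 0 :> int)%R).
  by apply: (eq_comb (c := 1%R) e); ring.
have al_sign : (al = 1 \/ al = - 1)%R.
  have [x [y e]] := tr_aut phi^-1 1%R 0%R.
  have : phi (tr x y) = tr 1%R 0%R by rewrite -e; exact: aut_invK.
  by rewrite f_tr be0 => /tr_inj[]; rewrite mul0r addr0 => /int_unit.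
have [E1 _] :
    (g1 + w1 + c1 = al * c1 + (p * (g1 - w1) + 2 * (r * t) * (g2 - w2)))%R /\
    (g2 - w2 + c2 = al * c2 + (p * (g2 - w2) + 2 * (s * u) * (g1 - w1)))%R.
  apply: tr_inj; apply: (mulIg (v^-1 * a)); have := congr1 phi sa_sv.
  rewrite !autM autV fa fv f_tr be0 ga0 de_al invgM trV -!mulgA sa_trA.
  rewrite sa_sv -!mulgA !trDA svV_trA trDA => e.
  by apply: etrans e _; congr (tr _ _ * _); ring.
have [e alE'] : exists e, al = kernel_sign e.
  by case: al_sign => ->; [exists false|exists true].
have g1E : g1 = (if e then (-1)%R else 0%R).
  by move: alE; rewrite alE' /kernel_sign {alE'}; case: e; clear; lia.
pose o1 := (if e then 1 - r else 0)%R; pose o2 := (if e then s else 0)%R.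
(* The first coordinate of the relation for a v, divided by 2r. *)
have key : (u * (w1 - o1) = t * (g2 + o2 - w2))%R.
  apply: (mulfI r0); apply: (mulfI (isT : 2%:R != 0 :> int)%R).
  move: E1; rewrite /o1 /o2 g1E alE' /kernel_sign; case: (e) => E1.
  - by apply: (eq_comb2 (c := 1%R) (c' := (w1 + 2 * r - 1)%R) E1 det1); ring.
  - by apply: (eq_comb2 (c := 1%R) (c' := w1) E1 det1); ring.
exists e, g2, (r * (g2 + o2 - w2) - s * (w1 - o1))%R.
split; first by rewrite fb de_al alE'.
- rewrite fv /v_shift -/o1 -/o2; congr (tr _ _ * _).
  + by apply: (eq_comb2 (c := r) (c' := (o1 - w1)%R) key det1); ring.
  + by apply: (eq_comb2 (c := (- s)%R) (c' := (g2 + o2 - w2)%R) key det1); ring.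
- by rewrite fa /a_shift g1E.
Qed.

(** * The kernel of the rise is (Z (+) Z) x| Z_2 *)

(** The data compose exactly as the elements of Z^2 extended by inversion. *)
Lemma kernel_datum_comp (f g : {multiplicative E -> E}) e n z e' n' z' :
  kernel_datum e n z f -> kernel_datum e' n' z' g ->
  kernel_datum (e (+) e') (n + kernel_sign e * n')%R (z + kernel_sign e * z')%R (f \o g).
Proof.
case=> fb fv fa [gb gv ga].
have fd : f (tr 1%R 0%R) = tr (kernel_sign e) 0%R.
  rewrite -sa_sa gmulfM fa /a_shift /kernel_sign -!mulgA sa_trA sa_sa !trD.
  by case: (e); congr tr; ring.
have f_tr x y : f (tr x y) = tr (kernel_sign e * x)%R (kernel_sign e * y)%R.
  by rewrite (hom_tr fd (etrans (congr1 f tr01) fb)); congr tr; ring.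
split=> /=.
- by rewrite gb f_tr /kernel_sign; case: (e); case: (e'); congr tr; ring.
- rewrite gv /v_shift gmulfM f_tr fv mulgA trD; congr (tr _ _ * _);
    by rewrite /kernel_sign; case: (e); case: (e') => /=; ring.
- rewrite ga /a_shift gmulfM f_tr fa mulgA trD; congr (tr _ _ * _);
    by rewrite /kernel_sign; case: (e); case: (e') => /=; ring.
Qed.

Lemma kernel_datum_id : kernel_datum false 0 0 (@idfun E).
Proof.
split=> //=; first by rewrite tr01.
  by rewrite /v_shift -[LHS]mul1g -tr00; congr (tr _ _ * _); ring.
by rewrite /a_shift tr00 mul1g.
Qed.

Lemma kernel_datum_eq (f g : {multiplicative E -> E}) e n z :
  kernel_datum e n z f -> kernel_datum e n z g -> f =1 g.
Proof.
by case=> fb fv fa [gb gv ga]; apply: sapphire_morph_eq; rewrite ?fb ?fv ?fa ?gb ?gv ?ga.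
Qed.

Lemma kernel_datum_inj (f : E -> E) e n z e' n' z' :
  kernel_datum e n z f -> kernel_datum e' n' z' f ->
  [/\ e = e', n = n' & z = z'].
Proof.
case=> fb fv fa []; rewrite fb fv fa.
move=> /tr_inj[_ ee] /mulIg/tr_inj[ez _] /mulIg/tr_inj[_ en].
have {}ee : e = e' by move: ee; rewrite /kernel_sign; case: (e); case: (e').
split=> //; apply: (mulfI t0); move: ez; rewrite ee; exact: addrI.
Qed.

Lemma kernel_aut e n z : exists phi : Aut0 B,
  rise (Aut0_incl phi) = 0%R /\ kernel_datum e n z (Aut0_incl phi).
Proof.
have ex e' n' z' : exists f : {multiplicative E -> E}, kernel_datum e' n' z' f.
  have [f [_ fb fv fa]] := sapphire_hom (kernel_relations e' n' z').
  by exists f.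
have aa : (kernel_sign e * kernel_sign e = 1)%R by rewrite /kernel_sign; case: (e).
have [f fD] := ex e n z.
have [g gD] := ex e (- (kernel_sign e * n))%R (- (kernel_sign e * z))%R.
have fg : f \o g =1 idfun.
  apply: (@kernel_datum_eq (f \o g) idfun _ _ _ _ kernel_datum_id).
  have := kernel_datum_comp fD gD.
  by rewrite addbb !mulrN !mulrA aa !mul1r !subrr.
have gf : g \o f =1 idfun.
  apply: (@kernel_datum_eq (g \o f) idfun _ _ _ _ kernel_datum_id).
  have := kernel_datum_comp gD fD.
  by rewrite addbb !addNr.
have f_aut : is_aut f by apply/asboolP; split; [exact: gmulfM|exists g].
have [_ fv fa] := fD.
have [|phi e1] := @Aut0_incl_onto (Aut f_aut).
  by rewrite /slope /= fv heightM height_tr flip_tr height_v.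
exists phi; rewrite e1; split=> //.
by rewrite /rise /= fa heightM height_tr height_a mulr0.
Qed.

Lemma kernel_iso : exists kappa : {multiplicative grpK -> Aut0 B},
  injective kappa /\ forall phi, Aut0k 0%R phi <-> exists x, kappa x = phi.
Proof.
pose nz (i : grpZ2) := i != 1.
pose c (x : grpZZ) k : int := (x : 'cV[int]_2) k 0%R.
pose datum (q : grpK) := kernel_datum (nz q.2) (c q.1 0%R) (c q.1 1%R).
have ex (q : grpK) : exists phi : Aut0 B,
    rise (Aut0_incl phi) = 0%R /\ datum q (Aut0_incl phi).
  exact: kernel_aut.
pose k q := projT1 (cid (ex q)).
have kD q : datum q (Aut0_incl (k q)) by rewrite /k; case: cid => ? [].
have kR q : rise (Aut0_incl (k q)) = 0%R by rewrite /k; case: cid => ? [].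
have cM x y l : c (x * y) l = (c x l + c y l)%R by rewrite /c mxE.
have cA i x l : c (neg_act i x) l = (kernel_sign (nz i) * c x l)%R.
  rewrite /c /= /neg_act_fun /nz; case: eqP => _ /=; first by rewrite mul1r.
  by rewrite mulNmx mul1mx mxE mulN1r.
have nzM i j : nz (i * j) = nz i (+) nz j.
  by case: (grpZ2P i) => ->; case: (grpZ2P j) => ->; rewrite ?genZ2_sqr.
have uniq q (phi psi : Aut0 B) :
    datum q (Aut0_incl phi) -> datum q (Aut0_incl psi) -> phi = psi.
  by move=> D1 D2; apply/Aut0_incl_inj/aut_ext/(kernel_datum_eq D1 D2).
have kM : {morph k : p q / p * q}.
  move=> q1 q2; apply: (uniq (q1 * q2)) => //.
  have e1 : (q1 * q2).1 = q1.1 * neg_act q1.2 q2.1 by [].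
  have e2 : (q1 * q2).2 = q1.2 * q2.2 by [].
  rewrite /datum e1 e2 nzM !cM !cA.
  exact: kernel_datum_comp (kD q1) (kD q2).
pose kappa : {multiplicative grpK -> Aut0 B} :=
  HB.pack k (isMultiplicative.Build _ _ k kM).
exists kappa; split=> [[x i] [y j] e|phi].
  have := kD (y, j); rewrite -[k (y, j)]e => D.
  have [/= ei e0 e1] := kernel_datum_inj (kD (x, i)) D.
  have -> : i = j.
    by move: ei; case: (grpZ2P i) => ->; case: (grpZ2P j) => ->.
  congr (_, _); apply/matrixP => l m; rewrite ord1.
  by case: l => -[|[|//]] lt; [move: e0|move: e1]; rewrite /c;
    congr (_ = _); congr (fun_of_matrix _ _ _); apply/val_inj.
rewrite Aut0kP; split=> [phi0|[q <-]]; last exact: kR.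
have [e [n [z D]]] := kernel_classification (Aut0_incl_slope phi) phi0.
pose x : 'cV[int]_2 := (\col_l (if l == 0 then n else z))%R.
exists (x, if e then genZ2 else 1); apply: (uniq _ _ _ (kD _)).
rewrite /datum /nz /c !mxE /=.
by case: (e) D.
Qed.

(** * The semidirect decompositions *)

(** Stated for any parametrization f of the automorphisms of slope 1, so as to
apply both to Aut_0(E) itself and to its decomposition by omega. *)
Lemma split_by_zeta (zeta : AutE B) (N : groupType)
    (f : {multiplicative N -> AutE B}) :
  zeta * zeta = 1 -> slope zeta = (- 1)%R -> injective f ->
  (forall phi, slope phi = 1%R <-> exists x, f x = phi) ->
  exists act : {multiplicative grpZ2 -> aut N},
    conj_through f zeta (act genZ2) /\ isog (AutE B) (sdprod act).
Proof.
move=> zz zs injf imf; have [s sE] := grpZ2_hom zz.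
have f1 x : slope (f x) = 1%R by apply/imf; exists x.
have [|||act [actE [lambda [lambda_bij _]]]] := @split_extension _ _ _ f s injf.
- move=> g x; apply/imf; rewrite !slopeM f1.
  have /eqP := slopeM g g^-1; rewrite mulgV slope1 mulr1 => /eqP; exact: esym.
- move=> g; case: (slope_sign g) => gs.
    by have [x <-] := proj1 (imf g) gs; exists x, 1; rewrite hom1 mulg1.
  have [|x e] := proj1 (imf (g * zeta)); first by rewrite slopeM gs zs.
  by exists x, genZ2; rewrite sE e -mulgA zz mulg1.
- move=> x h e; case: (grpZ2P h) => // hE; move: e; rewrite hE sE => e.
  by have := f1 x; rewrite e zs.
exists act; split; last exact: isog_sym lambda_bij.
by rewrite -sE; exact: actE.
Qed.

Lemma rise_zexpg (omega : Aut0 B) n :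
  rise (Aut0_incl (zexpg omega n)) = (rise (Aut0_incl omega) * n)%R.
Proof.
pose f m : grpZ := rise (Aut0_incl (zexpg omega m)).
pose g m : grpZ := (rise (Aut0_incl omega) * m)%R.
have fD m k : f (m + k)%R = f m * f k.
  by rewrite /f zexpgD; apply: riseM; exact: Aut0_incl_slope.
have gD m k : g (m + k)%R = g m * g k by exact: mulrDr.
have g1 : g 1%R = f 1%R by rewrite /g mulr1.
rewrite -[LHS]/(f n) (zexpg_unique (erefl (f 1%R)) fD).
by rewrite -(zexpg_unique g1 gD).
Qed.

Lemma rise_Aut0V (phi : Aut0 B) :
  rise (Aut0_incl phi^-1) = (- rise (Aut0_incl phi))%R.
Proof. by have := rise_zexpg phi (- 1)%R; rewrite mulrN1. Qed.

Lemma rise_Aut0M (phi psi : Aut0 B) :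
  rise (Aut0_incl (phi * psi)) = (rise (Aut0_incl phi) + rise (Aut0_incl psi))%R.
Proof. by apply: riseM; exact: Aut0_incl_slope. Qed.

Lemma is_omega_exists : exists omega : Aut0 B, is_omega omega.
Proof.
have [[psi psi1]|no] := pselect (exists psi : Aut0 B, Aut0k 1%R psi).
  by exists psi; left.
by have [phi phi2] := rise_inner_v; exists phi; right; split=> //; apply/Aut0kP.
Qed.

(** If no automorphism has rise 1, then all rises are even: an automorphism of
odd rise could be corrected by a power of omega, of rise 2. *)
Lemma is_omega_generates (omega phi : Aut0 B) : is_omega omega ->
  rise (Aut0_incl omega) <> 0%R /\
  exists n, rise (Aut0_incl phi) = (rise (Aut0_incl omega) * n)%R.
Proof.
case=> [/Aut0kP ->|[no /Aut0kP o2]].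
  by split=> //; exists (rise (Aut0_incl phi)); rewrite mul1r.
rewrite o2; split=> //; set k := rise _.
have [m [km|km]] : exists m, (k = 2 * m \/ k = 2 * m + 1)%R by exists (k %/ 2)%Z; lia.
  by exists m.
case: no; exists (phi * zexpg omega (- m)%R); apply/Aut0kP.
by rewrite rise_Aut0M rise_zexpg o2 -/k km; ring.
Qed.

Lemma Aut0_incl_image (phi : AutE B) :
  slope phi = 1%R <-> exists psi, Aut0_incl psi = phi.
Proof.
split; first exact: Aut0_incl_onto.
by case=> psi <-; exact: Aut0_incl_slope.
Qed.

Lemma Aut0_short_exact (zeta : AutE B) :
  slope zeta = (- 1)%R -> short_exact (@Aut0_incl B) (@Aut_sign B).
Proof.
move=> zs; split.
- exact: Aut0_inclM.
- exact: Aut_signM.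
- exact: Aut0_incl_inj.
- move=> i; case: (grpZ2P i) => ->; first by exists 1; apply/Aut_sign_eq1/slope1.
  by exists zeta; rewrite Aut_signE zs.
- by move=> phi; rewrite Aut_sign_eq1; exact: Aut0_incl_image.
Qed.

Lemma Aut_sign_splits (zeta : AutE B) :
  slope zeta = (- 1)%R -> zeta * zeta = 1 -> splits (@Aut_sign B).
Proof.
move=> zs zz; have [s sE] := grpZ2_hom zz; exists s => i.
case: (grpZ2P i) => ->; last by rewrite sE Aut_signE zs.
by rewrite hom1; apply/Aut_sign_eq1/slope1.
Qed.

Lemma split_by_omega (omega : Aut0 B) (kappa : {multiplicative grpK -> Aut0 B}) :
  is_omega omega -> injective kappa ->
  (forall phi, Aut0k 0%R phi <-> exists x, kappa x = phi) ->
  exists act : {multiplicative grpZ -> aut grpK},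
    conj_through kappa omega (act genZ) /\
  exists lambda : {multiplicative sdprod act -> Aut0 B},
    [/\ bijective lambda, forall x, lambda (x, 1) = kappa x
      & lambda (1, genZ) = omega].
Proof.
move=> omegaP kappa_inj kappa_im.
have [w wE] := grpZ_hom omega.
have [o0 _] := is_omega_generates omega omegaP.
have kr x : rise (Aut0_incl (kappa x)) = 0%R.
  by apply/Aut0kP/kappa_im; exists x.
have [||| act [actE [lambda [lambda_bij lambdaE]]]] :=
    @split_extension _ _ _ kappa w kappa_inj.
- move=> g x; apply/kappa_im/Aut0kP.
  by rewrite !rise_Aut0M rise_Aut0V kr; ring.
- move=> g; have [_ [n gn]] := is_omega_generates g omegaP.
  have [|x e] := proj1 (kappa_im (g * zexpg omega (- n)%R)).
    by apply/Aut0kP; rewrite rise_Aut0M rise_zexpg gn; ring.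
  by exists x, n; rewrite wE e zexpgN mulgVK.
- move=> x n e; have := kr x; rewrite e wE rise_zexpg => /eqP.
  by rewrite mulf_eq0 => /orP[/eqP|/eqP].
exists act; split; first by move=> x; rewrite (actE genZ) wE.
exists lambda; split=> //; first by move=> x; rewrite lambdaE hom1 mulg1.
by rewrite lambdaE hom1 mul1g wE.
Qed.

End SapphireGroup.

Theorem theorem4p10 (B : 'M[int]_2) (hGL : B \in unitmx)
    (hdet : (\det B = 1)%R)
    (hnz : (B 0 0 * B 0 1 * B 1 0 * B 1 1 != 0)%R) :
  [/\ short_exact (@Aut0_incl B) (@Aut_sign B),
      splits (@Aut_sign B)
    & exists zeta : AutE B,
      [/\ is_zeta zeta, typeII zeta, zeta <> 1, zeta * zeta = 1 &
      (exists alpha : {multiplicative grpZ2 -> aut (Aut0 B)},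
        conj_through (@Aut0_incl B) zeta (alpha genZ2) /\
        isog (AutE B) (sdprod alpha)) /\
      (exists omega : Aut0 B, is_omega omega) /\
      (forall omega : Aut0 B, is_omega omega ->
        exists kappa : {multiplicative grpK -> Aut0 B},
        [/\ injective kappa,
            forall phi, Aut0k 0%R phi <-> exists x, kappa x = phi &
        exists act_omega : {multiplicative grpZ -> aut grpK},
          conj_through kappa omega (act_omega genZ) /\
        exists lambda : {multiplicative sdprod act_omega -> Aut0 B},
        [/\ bijective lambda,
            forall x : grpK, lambda (x, 1) = kappa x,
            lambda (1, genZ) = omega &
        exists act_zeta : {multiplicative grpZ2 -> aut (sdprod act_omega)},
          conj_through (fun x => Aut0_incl (lambda x)) zeta (act_zeta genZ2) /\
          isog (AutE B) (sdprod act_zeta)]])]].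
Proof.
have det1 : (B 0 0 * B 1 1 - B 0 1 * B 1 0 = 1)%R by rewrite -hdet det_mx2.
have [zeta [zetaP zs zz]] := zeta_exists det1.
have imI := Aut0_incl_image det1 hnz.
split; [exact: Aut0_short_exact zs|exact: Aut_sign_splits zs zz|exists zeta].
split=> //; [exact/typeIIP|by move=> z1; rewrite z1 slope1 in zs|].
split; first exact: split_by_zeta zz zs (@Aut0_incl_inj B) imI.
split=> [|omega omegaP]; first exact: is_omega_exists.
have [kappa [kappa_inj kappa_im]] := kernel_iso det1 hnz.
exists kappa; split=> //.
have [act [actP [lambda [bij lk lo]]]] :=
  split_by_omega det1 hnz omegaP kappa_inj kappa_im.
exists act; split=> //; exists lambda; split=> //.
apply: (@split_by_zeta _ det1 hnz zeta _ (@Aut0_incl B \o lambda)) => //.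
  exact: inj_comp (@Aut0_incl_inj B) (bij_inj bij).
move=> phi; rewrite imI; have [mu lambdaK muK] := bij.
split=> [[psi <-]|[x <-]]; last by exists (lambda x).
by exists (mu psi); rewrite /= muK.
Qed.
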